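(* Let $r\ge k$ and $\vec b=(b_i)_{i\in[k]}$ be positive integers, let $\varepsilon>0$, and let $\mathfrak r$ be an index set with $|\mathfrak r|=r$. Let $\mathcal F=\bigcup_{h=1}^\infty\mathcal F_h$, where $\mathcal F_h$ is a family of $h$-vertex $k$-uniform $b_k$-colored $\mathfrak r$-partite hypergraphs. Then there exist constants $c>0$ and $h_0$ (depending only on $r,k,\vec b,\varepsilon,\mathcal F$) with the following property. Let $\mathbf\Omega=(\mathbf\Omega_i)_{i\in\mathfrak r}$ be a family of finite probability spaces and let $\mathbf G$ be a $k$-bound $\vec b$-colored $\mathfrak r$-partite hypergraph on $\mathbf\Omega$. Then at least one of the following two holds. (i) There exists a $k$-bound $\vec b$-colored $\mathfrak r$-partite hypergraph $\mathbf G'$ on $\mathbf\Omega$ such that $$\mathbb P_{\mathbf e\in\mathbf\Omega_I}[\mathbf G'(\mathbf e)\ne\mathbf G(\mathbf e)]\le\varepsilon\qquad\text{for all } I\in\tbinom{\mathfrak r}{k},$$ and for all $h\ge 1$ and all $F\in\mathcal F_h$, $$\mathbb P_{\phi\in\Phi(h)}[\mathbf G'(\phi(e))=F(e)\ \text{for all } e\in\mathbb V(F)]=0.$$ (ii) There exist $h\le h_0$ and $F\in\mathcal F_h$ such that $$\mathbb P_{\phi\in\Phi(h)}[\mathbf G(\phi(e))=F(e)\ \text{for all } e\in\mathbb V(F)]\ge c.$$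
   Context: Notation: $[a]=\{1,\dots,a\}$; $\binom{\mathfrak r}{i}$ is the set of $i$-element subsets of $\mathfrak r$, and $\binom{\mathfrak r}{[k]}=\bigcup_{i\in[k]}\binom{\mathfrak r}{i}$. For disjoint vertex sets $X_i$ ($i\in\mathfrak r$) and $J\subset\mathfrak r$, $X_J$ denotes the set of all $e\subset\bigcup_{j\in J}X_j$ with $|e\cap X_j|=1$ for every $j\in J$. Each $\mathbf\Omega_i$ is a nonempty finite set equipped with a probability measure on all its subsets (the sizes and measures may differ for different $i$). $\mathbb P_{\mathbf e\in\mathbf\Omega_I}$ means that $\mathbf e\in\mathbf\Omega_I$ is chosen by picking its vertices independently, the vertex in $\mathbf\Omega_i$ according to the probability measure of $\mathbf\Omega_i$, for $i\in I$. A $k$-bound $(b_i)_{i\in[k]}$-colored $\mathfrak r$-partite hypergraph $H$ consists of vertex sets $(X_i)_{i\in\mathfrak r}$, color sets $C_I$ with at most $b_{|I|}$ elements for each $I\in\binom{\mathfrak r}{[k]}$, and maps $\gamma_I:X_I\to C_I$. The elements of $X_I$ are called (index-$I$) edges, and one writes $H(e)=\gamma_I(e)$ for the color of $e\in X_I$. ''On $\mathbf\Omega$'' means that $X_i=\mathbf\Omega_i$ for all $i$. A $k$-uniform $b_k$-colored $\mathfrak r$-partite hypergraph $F$ is a $k$-bound $(b_i)_{i\in[k]}$-colored $\mathfrak r$-partite hypergraph such that (1) for $i<k$, $b_i=1$ and the unique color of each index of size $i$ is called invisible; and (2) for each $I$ with $|I|=k$, at most one index-$I$ color is called invisible. An edge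 is visible if its color is not invisible, and $\mathbb V(F)$ denotes the set of visible edges of $F$ (all of them are edges of size $k$). $F$ is $h$-vertex if each of its $r$ vertex sets has exactly $h$ elements. So that colors can be compared, the colors of index $I$, $|I|=k$, of $\mathbf G$ and $\mathbf G'$ and the visible colors of index $I$ of members of $\mathcal F$ are taken to be elements of the common set $[b_k]$ (the invisible color of $F$, if any, is not compared with colors of $\mathbf G$). For an $h$-vertex $F$ with vertex sets $W_i$, $|W_i|=h$ ($i\in\mathfrak r$), $\Phi(h)$ is the set of partitionwise maps $\phi$, i.e. maps from $\bigcup_{i\in\mathfrak r}W_i$ to $\bigcup_{i\in\mathfrak r}\mathbf\Omega_i$ with $\phi(W_i)\subset\mathbf\Omega_i$ for each $i$ (not required to be injective). $\mathbb P_{\phi\in\Phi(h)}$ means that $\phi$ is random: each vertex $w\in W_i$ is mapped, independently of all others, to a random element of $\mathbf\Omega_i$ distributed according to its probability measure. For an edge $e$, $\phi(e)$ is its image, an edge of the same index. *)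

(* Defs.v *)
From HB Require Import structures.
From mathcomp Require Import all_boot all_order all_algebra.
From mathcomp Require Import reals.

Set Implicit Arguments.
Unset Strict Implicit.
Unset Printing Implicit Defensive.

Import Order.TTheory GRing.Theory Num.Theory.
Local Open Scope ring_scope.

(* A probability measure on all subsets of a finite set is given by its point
   masses; nonemptiness follows from [mass_sum]. *)
Record fin_prob_space (R : realType) := FinProbSpace {
  outcome :> finType;
  mass : outcome -> R;
  mass_ge0 : forall x, 0 <= mass x;
  mass_sum : \sum_x mass x = 1
}.

(* Probability of the event [E] when the coordinates [x j], [j : J], are picked
   independently, each according to the measure of [S j]. *)
Definition prob (R : realType) (J : finType) (S : J -> fin_prob_space R)
    (E : pred {dffun forall j : J, S j}) : R :=
  \sum_(x : {dffun forall j : J, S j} | E x) \prod_(j : J) mass (x j).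

Definition index_set (V : finType) (k : nat) : finType :=
  {I : {set V} | (0 < #|I| <= k)%N}.

(* An edge of index [I] picks exactly one vertex of [X j] for each [j \in I];
   it is represented by the corresponding choice function. *)
Definition edge (V : finType) (X : V -> finType) (I : {set V}) : finType :=
  {dffun forall j : {j : V | j \in I}, X (val j)}.

(* The color set of index [I] is a subset of the standard set of [b #|I|]
   elements; as colors need not be used, the whole standard set is taken. *)
Record hypergraph (V : finType) (k : nat) (b : nat -> nat) (X : V -> finType) :=
  Hypergraph { color : forall I : index_set V k, edge X (val I) -> 'I_(b #|val I|) }.

Arguments color {V k b X} h {I} e.

Definition hypergraph_on (R : realType) (V : finType) (k : nat) (b : nat -> nat)
    (Om : V -> fin_prob_space R) :=
  hypergraph k b (fun i => outcome (Om i)).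

Definition uniform_bound (k bk i : nat) : nat := if i == k then bk else 1%N.

(* The invisible color counts among the at most [bk] colors of its index, so it
   can be labelled by an element of the standard set that is not the label of a
   visible color; it is never compared with a color of another hypergraph. *)
Record uniform_hypergraph (V : finType) (k bk : nat) := UniformHypergraph {
  vertices : V -> finType;
  graph :> hypergraph k (uniform_bound k bk) vertices;
  invisible : forall I : index_set V k, option 'I_(uniform_bound k bk #|val I|);
  invisible_low : forall I : index_set V k, (#|val I| < k)%N -> invisible I != None
}.

Definition h_vertex (V : finType) (k bk h : nat)
    (F : uniform_hypergraph V k bk) : Prop :=
  forall i : V, #|vertices F i| = h.

(* Below size [k] the only color is invisible, so these all have size [k]. *)
Definition visible_edges (V : finType) (k bk : nat)
    (F : uniform_hypergraph V k bk) :
    {set {I : index_set V k & edge (vertices F) (val I)}} :=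
  [set e | Some (color F (tagged e)) != invisible F (tag e)].

(* The disjoint union of the [W i] is the sigma type [{i : V & W i}]. *)
Definition pmap_image (V : finType) (W X : V -> finType)
    (phi : {dffun forall w : {i : V & W i}, X (tag w)}) (I : {set V})
    (e : edge W I) : edge X I :=
  [ffun j : {j : V | j \in I} => phi (Tagged W (e j))].

(* Colors are compared through their values in nat: for a visible edge, which
   has size [k], both color types are the standard set of [b k] elements. *)
Definition copy (R : realType) (V : finType) (k : nat) (b : nat -> nat)
    (Om : V -> fin_prob_space R) (G : hypergraph_on k b Om)
    (F : uniform_hypergraph V k (b k))
    (phi : {dffun forall w : {i : V & vertices F i}, Om (tag w)}) : bool :=
  [forall e in visible_edges F,
     color G (pmap_image phi (tagged e)) == color F (tagged e) :> nat].

Definition copy_prob (R : realType) (V : finType) (k : nat) (b : nat -> nat)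
    (Om : V -> fin_prob_space R) (G : hypergraph_on k b Om)
    (F : uniform_hypergraph V k (b k)) : R :=
  prob (S := fun w : {i : V & vertices F i} => Om (tag w)) (@copy R V k b Om G F).

Definition recolor_prob (R : realType) (V : finType) (k : nat) (b : nat -> nat)
    (Om : V -> fin_prob_space R) (G' G : hypergraph_on k b Om)
    (I : index_set V k) : R :=
  prob (S := fun j : {j : V | j \in val I} => Om (val j))
    (fun e => color G' (e : edge (fun i => outcome (Om i)) (val I)) != color G e).

(* Main.v *)
Require Import Defs.
From HB Require Import structures.
From mathcomp Require Import boolp classical_sets filter reals.
From mathcomp Require Import all_boot all_order all_algebra.
From mathcomp Require Import ring lra zify.

Set Implicit Arguments.
Unset Strict Implicit.
Unset Printing Implicit Defensive.

Import Order.TTheory GRing.Theory Num.Theory.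
Local Open Scope ring_scope.

(** The theorem is first turned into a statement about a sequence of structures
    of which every copy density tends to [0] but which cannot be repaired.  All
    densities are evaluated along one fixed ultrafilter, so that quantities such
    as energies have limits, and thresholds can be chosen against these limits
    instead of through nested growth functions.

    Sample [N] vertices of each part.  The block of a face [e] is the pattern
    seen on [e] together with the sample, the faces of smaller dimension using
    larger samples.  If the sample sizes are chosen by the supremum of the
    energies, the block of [e] is almost independent of everything not containing
    [e], given the blocks of the proper subfaces of [e]: by exchangeability, the
    other vertices are just further samples.  Hence the joint law of all blocks on
    any finite vertex set is close to that of a Bayesian network.

    To repair the [n]-th structure, sample it coarsely, and redraw the fine block
    of every face from its conditional law given its coarse block and the fine
    blocks of its subfaces; when that coarse block is too unlikely, redraw from
    the law given the subfaces only.  The fine blocks live in the structure of a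
    much larger index [n'].  Redrawing typically preserves the colors, and its law
    has a density with respect to the network that is bounded independently of
    how fine the blocks are.  So the patterns with limit density [0] are avoided
    altogether, which leaves no copy of a forbidden hypergraph. *)

(** * Ultrafilter limits and finite expectations *)

Section Ultra.
Variables (U : set_system nat) (UU : UltraFilter U).

Lemma ultraT (P : set nat) : (forall n, P n) -> U P.
Proof. by move=> h; apply: (@filterS _ U _ classical_sets.setT) => //; apply: filterT. Qed.

Lemma ultraS (P Q : set nat) : (forall n, P n -> Q n) -> U P -> U Q.
Proof. exact: filterS. Qed.

Lemma ultraI (P Q : set nat) : U P -> U Q -> U [set n | P n /\ Q n]%classic.
Proof. exact: filterI. Qed.

Lemma ultra_ex (P : set nat) : U P -> exists n, P n.
Proof. exact: filter_ex. Qed.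

Lemma ultraN (P : set nat) : ~ U P -> U [set n | ~ P n]%classic.
Proof. by move=> nP; case: (in_ultra_setVsetC P UU). Qed.

Lemma ultra_all (I : finType) (P : I -> set nat) :
  (forall i, U (P i)) -> U [set n | forall i, P i n]%classic.
Proof.
move=> h; suff : U [set n | forall i, i \in enum I -> P i n]%classic.
  by apply: ultraS => n /= hn i; apply: hn; rewrite mem_enum.
elim: (enum I) => [|i s IH]; first by apply: ultraT.
apply: ultraS (ultraI (h i) IH) => n /= [h1 h2] j.
by rewrite inE => /orP[/eqP ->|/h2].
Qed.

(** The limit is the supremum of all numbers lying below [u n] for [U]-almost all [n]. A number
    above the supremum exceeds [u n] almost always, because an ultrafilter decides every set. *)
Lemma ultra_lim (R : realType) (u : nat -> R) (a b : R) :
  (forall n, a <= u n <= b) ->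
  exists l, forall d, 0 < d -> U [set n | `|u n - l| < d]%classic.
Proof.
move=> hu.
pose E := [set x | U [set n | x <= u n]]%classic.
have EP x : E x -> x <= b.
  move=> /ultra_ex [n /= xn]; apply: le_trans xn _.
  by have /andP[] := hu n.
have supE : has_sup E.
  split; last by exists b => x /EP.
  by exists a; apply: ultraT => n /=; have /andP[] := hu n.
exists (sup E) => d d0.
have [e Ee ed] := sup_adherent d0 supE.
have nE : ~ E (sup E + d / 2).
  by move=> /(sup_upper_bound supE); lra.
apply: ultraS (ultraI Ee (ultraN nE)) => n /= [h1 /negP].
by rewrite -ltNge ltr_norml => h2; lra.
Qed.

End Ultra.

Section Mean.
Variables (R : realType) (Psi : finType) (w : Psi -> R).
Hypothesis w_ge0 : forall x, 0 <= w x.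
Hypothesis w_sum : \sum_x w x = 1.

Definition mean (f : Psi -> R) : R := \sum_x w x * f x.

Lemma eq_mean f g : f =1 g -> mean f = mean g.
Proof. by move=> fg; apply: eq_bigr => x _; rewrite fg. Qed.

Lemma meanD f g : mean (fun x => f x + g x) = mean f + mean g.
Proof. by rewrite /mean -big_split; apply: eq_bigr => x _; rewrite /= mulrDr. Qed.

Lemma meanZ c f : mean (fun x => c * f x) = c * mean f.
Proof. by rewrite /mean big_distrr; apply: eq_bigr => x _; rewrite /= mulrCA. Qed.

Lemma meanB f g : mean (fun x => f x - g x) = mean f - mean g.
Proof. by rewrite /mean -sumrB; apply: eq_bigr => x _; rewrite mulrBr. Qed.

Lemma mean_sum (I : Type) (r : seq I) (P : pred I) (F : I -> Psi -> R) :
  mean (fun x => \sum_(i <- r | P i) F i x) = \sum_(i <- r | P i) mean (F i).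
Proof. by rewrite /mean exchange_big; apply: eq_bigr => x _; rewrite big_distrr. Qed.

Lemma mean_cst c : mean (fun=> c) = c.
Proof. by rewrite /mean -big_distrl /= w_sum mul1r. Qed.

Lemma mean_ge0 f : (forall x, 0 <= f x) -> 0 <= mean f.
Proof. by move=> f0; apply: sumr_ge0 => x _; rewrite mulr_ge0. Qed.

Lemma ler_mean f g : (forall x, f x <= g x) -> mean f <= mean g.
Proof. by move=> fg; apply: ler_sum => x _; rewrite ler_wpM2l. Qed.

Lemma ler_norm_mean f : `|mean f| <= mean (fun x => `|f x|).
Proof.
apply: le_trans (ler_norm_sum _ _ _) _; apply: ler_sum => x _.
by rewrite normrM (ger0_norm (w_ge0 x)).
Qed.

Lemma mean_sqr f : mean f ^+ 2 <= mean (fun x => f x ^+ 2).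
Proof.
have : 0 <= mean (fun x => (f x - mean f) ^+ 2) by apply: mean_ge0 => x; rewrite sqr_ge0.
suff -> : mean (fun x => (f x - mean f) ^+ 2) = mean (fun x => f x ^+ 2) - mean f ^+ 2.
  by rewrite subr_ge0.
rewrite (@eq_mean _ (fun x => (f x ^+ 2 - (2 * mean f) * f x) + mean f ^+ 2)); last first.
  by move=> x; ring.
by rewrite meanD meanB meanZ mean_cst; ring.
Qed.

Lemma mean_norm_le f d : 0 <= d -> mean (fun x => f x ^+ 2) <= d ^+ 2 ->
  mean (fun x => `|f x|) <= d.
Proof.
move=> d0 hf; have m0 : 0 <= mean (fun x => `|f x|) by apply: mean_ge0.
rewrite -(ler_pXn2r (n := 2)) ?nnegrE //; apply: le_trans hf.
apply: le_trans (mean_sqr _) _; apply: ler_mean => x.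
by rewrite real_normK ?num_real.
Qed.

Lemma mean_lt_ex f c : mean f < c -> exists x, f x < c.
Proof.
move=> fc; apply: contrapT => h.
suff : c <= mean f by rewrite leNgt fc.
rewrite -[c]mean_cst; apply: ler_mean => x; rewrite leNgt; apply/negP => fx.
by apply: h; exists x.
Qed.

Section CondExp.
Variables (T : eqType) (Z : Psi -> T).

(** Conditional expectation given the partition into fibres of [Z]; on a fibre of mass 0 the
    division makes it 0. *)
Definition cexp (f : Psi -> R) (x : Psi) : R :=
  mean (fun x' => (Z x' == Z x)%:R * f x') / mean (fun x' => (Z x' == Z x)%:R).

Lemma cexp_fac f x x' : Z x = Z x' -> cexp f x = cexp f x'.
Proof. by rewrite /cexp => ->. Qed.

Lemma mean_class_eq0 x : mean (fun x' => (Z x' == Z x)%:R) = 0 -> w x = 0.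
Proof.
move/eqP; rewrite psumr_eq0 => [/allP/(_ x)|x' _]; last by rewrite mulr_ge0.
by rewrite mem_index_enum eqxx mulr1 => /(_ isT)/eqP.
Qed.

(** Both sides expand to one double sum over pairs in a common fibre, where the order of summation
    can be exchanged. Fibres of mass 0 consist of points of weight 0. *)
Lemma mean_cexpM f g : (forall x x', Z x = Z x' -> g x = g x') ->
  mean (fun x => cexp f x * g x) = mean (fun x => f x * g x).
Proof.
move=> gZ; pose m x := mean (fun x' => (Z x' == Z x)%:R).
have mZ x x' : Z x = Z x' -> m x = m x' by rewrite /m => ->.
transitivity (\sum_x \sum_x' w x * w x' * (Z x' == Z x)%:R * (f x' * g x' / m x')).
  apply: eq_bigr => x _; rewrite /cexp -/(m x) [mean _]/mean big_distrl /= big_distrl /= big_distrr /=.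
  apply: eq_bigr => x' _; case: eqP => [e|]; last by rewrite !(mul0r, mulr0).
  by rewrite (gZ _ _ e) (mZ _ _ e); ring.
rewrite exchange_big; apply: eq_bigr => x' _ /=.
transitivity (w x' * (f x' * g x' / m x') * m x').
  rewrite [X in _ = _ * X]/mean big_distrr /=; apply: eq_bigr => x _.
  by rewrite eq_sym; ring.
have [m0|m0] := eqVneq (m x') 0; first by rewrite (mean_class_eq0 m0) !mul0r.
by rewrite -mulrA divfK.
Qed.

Lemma cexp_sum (I : Type) (r : seq I) (P : pred I) (F : I -> Psi -> R) x :
  cexp (fun x => \sum_(i <- r | P i) F i x) x = \sum_(i <- r | P i) cexp (F i) x.
Proof.
rewrite /cexp -big_distrl /= -mean_sum; congr (_ / _).
by apply: eq_mean => x'; rewrite big_distrr.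
Qed.

(** The energy (index) of a partition, as in energy-increment proofs of regularity. *)
Definition energy f := mean (fun x => cexp f x ^+ 2).

Lemma energy_ge0 f : 0 <= energy f.
Proof. by apply: mean_ge0 => x; rewrite sqr_ge0. Qed.

Lemma energy_mean f : energy f = mean (fun x => f x * cexp f x).
Proof.
rewrite -mean_cexpM; last exact: cexp_fac.
by apply: eq_mean => x; rewrite expr2.
Qed.

Lemma energy_le1 f : (forall x, f x ^+ 2 <= 1) -> energy f <= 1.
Proof.
move=> f1; apply: (@le_trans _ _ (mean (fun x => f x ^+ 2))); last first.
  by rewrite -[X in _ <= X]mean_cst; apply: ler_mean.
have : 0 <= mean (fun x => (f x - cexp f x) ^+ 2).
  by apply: mean_ge0 => x; rewrite sqr_ge0.
suff -> : mean (fun x => (f x - cexp f x) ^+ 2) = mean (fun x => f x ^+ 2) - energy f.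
  by rewrite subr_ge0.
rewrite (@eq_mean _ (fun x => (f x ^+ 2 - 2 * (f x * cexp f x)) + cexp f x ^+ 2)).
  by rewrite meanD meanB meanZ -energy_mean -/(energy f); ring.
by move=> x; ring.
Qed.

End CondExp.

Lemma eq_cexp (T T' : eqType) (Z : Psi -> T) (Z' : Psi -> T') f g x :
  (forall x', (Z x' == Z x) = (Z' x' == Z' x)) -> f =1 g ->
  cexp Z f x = cexp Z' g x.
Proof.
move=> ZZ fg; rewrite /cexp; congr (_ / _); apply: eq_mean => x'; rewrite ZZ //.
by rewrite fg.
Qed.

Section Refine.
Variables (T2 T3 : eqType) (Z2 : Psi -> T2) (Z3 : Psi -> T3).
Hypothesis Z23 : forall x x', Z3 x = Z3 x' -> Z2 x = Z2 x'.

(** Pythagoras: the coarser conditional expectation is the orthogonal projection of the finer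
    one. *)
Lemma mean_cexp_sub f :
  mean (fun x => (cexp Z3 f x - cexp Z2 f x) ^+ 2) = energy Z3 f - energy Z2 f.
Proof.
have e23 : mean (fun x => cexp Z3 f x * cexp Z2 f x) = energy Z2 f.
  rewrite mean_cexpM ?energy_mean // => x x' /Z23; exact: cexp_fac.
rewrite (@eq_mean _ (fun x => (cexp Z3 f x ^+ 2 - 2 * (cexp Z3 f x * cexp Z2 f x)) + cexp Z2 f x ^+ 2)).
  by rewrite meanD meanB meanZ e23 -/(energy Z3 f) -/(energy Z2 f); ring.
by move=> x; ring.
Qed.

Lemma energy_mono f : energy Z2 f <= energy Z3 f.
Proof.
by rewrite -subr_ge0 -mean_cexp_sub; apply: mean_ge0 => x; rewrite sqr_ge0.
Qed.

Lemma mean_cexp_norm f d : 0 <= d -> energy Z3 f <= energy Z2 f + d ^+ 2 ->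
  mean (fun x => `|cexp Z3 f x - cexp Z2 f x|) <= d.
Proof.
by move=> d0 h; apply: mean_norm_le => //; rewrite mean_cexp_sub lerBlDl.
Qed.

(** Against a [Z3]-measurable [g], [f] may be replaced by its projection to [Z3], which is close to
    the projection to [Z2] when the energies nearly agree. Regularity is used in this form. *)
Lemma mean_cexp_dual f g d : 0 <= d -> energy Z3 f <= energy Z2 f + d ^+ 2 ->
  (forall x x', Z3 x = Z3 x' -> g x = g x') -> (forall x, `|g x| <= 1) ->
  `|mean (fun x => (f x - cexp Z2 f x) * g x)| <= d.
Proof.
move=> d0 hd gZ g1; apply: le_trans (mean_cexp_norm d0 hd).
have -> : mean (fun x => (f x - cexp Z2 f x) * g x) =
          mean (fun x => (cexp Z3 f x - cexp Z2 f x) * g x).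
  transitivity (mean (fun x => f x * g x) - mean (fun x => cexp Z2 f x * g x)).
    by rewrite -meanB; apply: eq_mean => x; rewrite mulrBl.
  rewrite -(mean_cexpM (Z := Z3) f gZ) -meanB; apply: eq_mean => x.
  by rewrite mulrBl.
apply: le_trans (ler_norm_mean _) _; apply: ler_mean => x.
by rewrite normrM ler_piMr.
Qed.

End Refine.
End Mean.

(** Coordinates outside the image of [rho] are summed freely and contribute a factor 1. *)
Lemma marginal (R : realType) (J K T : finType) (rho : J -> K)
    (rho_inj : injective rho) (mu : K -> T -> R) (f : {ffun J -> T} -> R) :
  (forall k, \sum_t mu k t = 1) ->
  \sum_(psi : {ffun K -> T}) (\prod_k mu k (psi k)) * f [ffun j => psi (rho j)] =
  \sum_(chi : {ffun J -> T}) (\prod_j mu (rho j) (chi j)) * f chi.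
Proof.
move=> mu1.
rewrite (partition_big (fun psi : {ffun K -> T} => [ffun j => psi (rho j)]) predT) //=.
apply: eq_bigr => chi _.
rewrite (eq_bigr (fun psi : {ffun K -> T} => (\prod_k mu k (psi k)) * f chi)); last first.
  by move=> psi /eqP ->.
rewrite -big_distrl /=; congr (_ * _).
(* [Q k] fixes the value at [k = rho j] to be [chi j] and allows everything off the image, so the
   fibre over [chi] is a product set. *)
pose Q k := [pred t | [forall j, (rho j == k) ==> (t == chi j)]].
rewrite (eq_bigl (fun psi => psi \in family Q)); last first.
  move=> psi; apply/eqP/familyP => [e k|h].
    by rewrite inE; apply/forallP => j; apply/implyP => /eqP <-; rewrite -e ffunE.
  apply/ffunP => j; rewrite ffunE; have := h (rho j); rewrite inE => /forallP/(_ j).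
  by rewrite eqxx => /eqP.
rewrite -bigA_distr_big_dep (bigID (mem (codom rho))) /= mulrC big1 ?mul1r; last first.
  move=> k nk; rewrite -[RHS](mu1 k); apply: eq_bigl => t; apply/forallP => j.
  by apply/implyP => /eqP e; rewrite -e codom_f in nk.
rewrite (eq_bigr (fun k => \prod_(j | rho j == k) \sum_(t | Q k t) mu k t)); last first.
  move=> k /codomP[j ->]; rewrite (big_pred1 j) // => j'; exact: inj_eq.
rewrite (exchange_big_dep predT) //=; apply: eq_bigr => j _.
rewrite (big_pred1 (rho j)) => [|k]; last first.
  by rewrite eq_sym andb_idl // => /eqP ->; apply: codom_f.
rewrite (big_pred1 (chi j)) // => t; apply/forallP/eqP => [/(_ j)|-> j'].
  by rewrite eqxx => /eqP.
by apply/implyP => /eqP/rho_inj ->.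
Qed.

(** * Sequential random processes *)

Section Process.
Variables (R : realType) (K : eqType) (B : finType).
Implicit Types (ker : K -> (K -> B) -> B -> R) (f g : (K -> B) -> R) (y : K -> B).

Definition upd y (e : K) (v : B) : K -> B := fun e' => if e' == e then v else y e'.

(** A Bayesian network in terms of expectations only: the value of [f] is averaged over successive
    draws at the places in [l], each draw depending on the current values. *)
Fixpoint proc ker (l : seq K) f y : R :=
  if l is e :: l' then \sum_v ker e y v * proc ker l' f (upd y e v) else f y.

Lemma eq_proc_on ker l f g y :
  (forall y', (forall e, e \notin l -> y' e = y e) -> f y' = g y') ->
  proc ker l f y = proc ker l g y.
Proof.
elim: l y => [|e l IH] y h /=; first by apply: h.
apply: eq_bigr => v _; congr (_ * _); apply: IH => y' hy'; apply: h => e'.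
by rewrite inE negb_or => /andP[/negPf n1 /hy' ->]; rewrite /upd n1.
Qed.

Lemma proc_sum (I : Type) (r : seq I) ker l (c : I -> R) (F : I -> (K -> B) -> R) y :
  proc ker l (fun y => \sum_(i <- r) c i * F i y) y =
  \sum_(i <- r) c i * proc ker l (F i) y.
Proof.
elim: l y => [//|e l IH] y /=; under eq_bigr do rewrite IH big_distrr /=.
rewrite exchange_big; apply: eq_bigr => i _ /=; rewrite big_distrr /=.
by apply: eq_bigr => v _; rewrite mulrCA.
Qed.

Lemma proc_ge0 ker l f y : (forall e y v, 0 <= ker e y v) ->
  (forall y, 0 <= f y) -> 0 <= proc ker l f y.
Proof.
move=> k0 f0; elim: l y => [//|e l IH] y /=.
by apply: sumr_ge0 => v _; rewrite mulr_ge0.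
Qed.

Lemma ler_proc ker l f g y : (forall e y v, 0 <= ker e y v) ->
  (forall y, f y <= g y) -> proc ker l f y <= proc ker l g y.
Proof.
move=> k0 fg; elim: l y => [//|e l IH] y /=.
by apply: ler_sum => v _; rewrite ler_wpM2l.
Qed.

(** Density bounds multiply along the steps; the factor depends on the number of steps but not on
    the size of [B]. *)
Lemma proc_dom ker1 ker2 c l f y :
  (forall e y v, 0 <= ker1 e y v <= c * ker2 e y v) -> 0 <= c ->
  (forall y, 0 <= f y) -> proc ker1 l f y <= c ^+ size l * proc ker2 l f y.
Proof.
move=> hk c0 f0; elim: l y => [|e l IH] y /=; first by rewrite expr0 mul1r.
rewrite big_distrr /=; apply: ler_sum => v _.
rewrite [X in _ <= X](_ : _ = c * ker2 e y v * (c ^+ size l * proc ker2 l f (upd y e v))).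
  have /andP[h1 h2] := hk e y v; apply: ler_pM; [by []| |by []|exact: IH].
  by apply: proc_ge0 => // e' y' v'; have /andP[] := hk e' y' v'.
by rewrite exprS; ring.
Qed.

Section Stochastic.
Variable ker : K -> (K -> B) -> B -> R.
Hypothesis ker_ge0 : forall e y v, 0 <= ker e y v.
Hypothesis ker_sum : forall e y, \sum_v ker e y v = 1.

Lemma proc_cst l c y : proc ker l (fun=> c) y = c.
Proof.
elim: l y => [//|e l IH] y /=; under eq_bigr do rewrite IH.
by rewrite -big_distrl /= ker_sum mul1r.
Qed.

Lemma proc_norm l f y : (forall y, `|f y| <= 1) -> `|proc ker l f y| <= 1.
Proof.
move=> f1; rewrite ler_norml -[X in X <= _ <= _](proc_cst l (-1) y).
rewrite -[X in _ <= _ <= X](proc_cst l 1 y).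
by apply/andP; split; apply: ler_proc => // y'; have := f1 y'; rewrite ler_norml => /andP[].
Qed.

Lemma proc_lt_ex l f y c : proc ker l f y < c -> exists y', f y' < c.
Proof.
move=> fc; apply: contrapT => h.
suff : c <= proc ker l f y by rewrite leNgt fc.
rewrite -[X in X <= _](proc_cst l c y); apply: ler_proc => // y'.
by rewrite leNgt; apply/negP => fx; apply: h; exists y'.
Qed.

Definition seen (Psi : Type) (Y : K -> Psi -> B) (l1 : seq K) (y0 : K -> B) x : K -> B :=
  fun e => if e \in l1 then Y e x else y0 e.

(* Telescoping over the prefixes of [l]: the values on a prefix are the true
   ones, and the remaining ones are drawn by the process. *)
Lemma hybrid (Psi : finType) (w : Psi -> R) (Y : K -> Psi -> B) l f (y0 : K -> B) d :
  \sum_x w x = 1 ->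
  (forall y, `|f y| <= 1) ->
  (forall l1 e l2, l = l1 ++ e :: l2 ->
   forall G : (K -> B) -> B -> R, (forall y v, `|G y v| <= 1) ->
   `|mean w (fun x => \sum_v ((Y e x == v)%:R - ker e (seen Y l1 y0 x) v) * G (seen Y l1 y0 x) v)| <= d) ->
  `|mean w (fun x => f (seen Y l y0 x)) - proc ker l f y0|
    <= (size l)%:R * d.
Proof.
move=> w1 f1 H.
pose y1 l1 x := seen Y l1 y0 x.
suff S l1 l2 : l = l1 ++ l2 ->
   `|mean w (fun x => proc ker l2 f (y1 l1 x)) - mean w (fun x => f (y1 l x))|
     <= (size l2)%:R * d.
  by rewrite distrC -(mean_cst w1 (proc ker l f y0)); apply: (S [::]).
elim: l2 l1 => [|e l2 IH] l1 el.
  by rewrite el cats0 subrr normr0 mul0r.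
have := IH (rcons l1 e); rewrite cat_rcons => /(_ el) h.
(* The test function of one step is the expected outcome of the remaining process once [e] has
   received the value [v]. *)
have := H _ _ _ el (fun y v => proc ker l2 f (upd y e v)).
move=> /(_ (fun y v => proc_norm _ _ f1)) /=.
set D := mean _ _ => hD.
have eD : D = mean w (fun x => proc ker l2 f (y1 (rcons l1 e) x)) -
              mean w (fun x => proc ker (e :: l2) f (y1 l1 x)).
  rewrite -meanB; apply: eq_mean => x /=; rewrite -/(y1 l1 x).
  under eq_bigr do rewrite mulrBl.
  rewrite sumrB; congr (_ - _).
  rewrite (bigD1 (Y e x)) //= eqxx mul1r big1 ?addr0; last first.
    by move=> v /negPf nv; rewrite eq_sym nv mul0r.
  congr (proc _ _ _ _); apply: funext => e'; rewrite /upd /y1 /seen mem_rcons inE.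
  by case: eqP => [->|].
rewrite eD distrC in hD; rewrite /= -natr1 mulrDl mul1r [X in _ <= X]addrC.
by apply: le_trans (ler_distD _ _ _) _; apply: lerD hD h.
Qed.

End Stochastic.

End Process.

(** A functional reading only the places [iota J] is unaffected by draws elsewhere, and those
    integrate to 1. *)
Lemma proc_pull (R : realType) (K K' : eqType) (B : finType)
    (ker : K -> (K -> B) -> B -> R) (ker' : K' -> (K' -> B) -> B -> R)
    (iota : K' -> K) (P : pred K) (dd : K -> K') (l : seq K) f y :
  (forall e, P e -> iota (dd e) = e) ->
  (forall J, P (iota J) /\ dd (iota J) = J) ->
  (forall e y v, P e -> ker e y v = ker' (dd e) (y \o iota) v) ->
  (forall e y, \sum_v ker e y v = 1) ->
  proc ker l (fun y => f (y \o iota)) y =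
  proc ker' [seq dd e | e <- l & P e] f (y \o iota).
Proof.
move=> h1 h2 h3 h4; elim: l y => [//|e l IH] y /=.
case: ifP => Pe /=.
  apply: eq_bigr => v _; rewrite h3 // IH; congr (_ * proc _ _ _ _).
  apply: funext => J /=; rewrite /upd; congr (if _ then _ else _).
  apply/eqP/eqP => [<-|->]; last exact: h1.
  by have [] := h2 J.
under eq_bigr => v _.
  rewrite IH (_ : upd y e v \o iota = y \o iota).
    over.
  apply: funext => J /=; rewrite /upd; case: eqP => // eJ.
  by have [] := h2 J; rewrite eJ Pe.
by rewrite -big_distrl /= h4 mul1r.
Qed.

(** The first components never look at the second ones, so all of them can be drawn beforehand. As
    [l] has no repetition, the first component at [e] is final once drawn, and the second kernel at
    [e] can use it either way. *)
Lemma proc_pair (R : realType) (K : eqType) (A B : finType)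
    (k0 : K -> (K -> A) -> A -> R) (k1 : K -> A -> (K -> B) -> B -> R)
    (l : seq K) (f : (K -> A) -> (K -> B) -> R) (a : K -> A) (y : K -> B) :
  uniq l ->
  proc (fun e (z : K -> A * B) (uv : A * B) =>
          k0 e (fun e' => (z e').1) uv.1 * k1 e uv.1 (fun e' => (z e').2) uv.2) l
    (fun z => f (fun e => (z e).1) (fun e => (z e).2)) (fun e => (a e, y e)) =
  proc k0 l (fun a' => proc (fun e => k1 e (a' e)) l (f a') y) a.
Proof.
elim: l a y => [//|e l IH] a y /= /andP[el ul].
transitivity (\sum_u k0 e a u * (\sum_v k1 e u y v *
    proc k0 l (fun a' => proc (fun e => k1 e (a' e)) l (f a') (upd y e v)) (upd a e u))).
  under [RHS]eq_bigr do rewrite big_distrr /=.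
  rewrite [RHS]pair_big /=; apply: eq_bigr => -[u v] _ /=.
  rewrite -mulrA -(IH _ _ ul); do 2 congr (_ * _).
  by congr (proc _ _ _ _); apply: funext => e'; rewrite /upd; case: eqP.
apply: eq_bigr => u _; congr (_ * _); rewrite -proc_sum.
apply: eq_proc_on => a' /(_ e el) ea.
by rewrite ea /upd eqxx.
Qed.

(** * Faces and blocks *)

Section Faces.
Variable V : finType.

(** A face is a partial choice of at most one vertex per part, so faces of all indices share one
    type; [dom] is the index of the face. *)
Definition dom (A : Type) (k : {ffun V -> option A}) : {set V} :=
  [set i | isSome (k i)].

Definition rst (A : Type) (k : {ffun V -> option A}) (J : {set V}) :
  {ffun V -> option A} := [ffun i => if i \in J then k i else None].

Definition sub (A : eqType) (e e' : {ffun V -> option A}) : bool :=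
  [forall i, (e i == None) || (e' i == e i)].

Lemma dom_rst (A : Type) (k : {ffun V -> option A}) (J : {set V}) : dom (rst k J) = J :&: dom k.
Proof. by apply/setP => i; rewrite !inE ffunE; case: (i \in J). Qed.

Lemma rst_rst (A : Type) (k : {ffun V -> option A}) (I J : {set V}) : rst (rst k I) J = rst k (J :&: I).
Proof. by apply/ffunP => i; rewrite !ffunE inE; case: (i \in J). Qed.

Lemma rst_id (A : Type) (k : {ffun V -> option A}) (J : {set V}) : dom k \subset J -> rst k J = k.
Proof.
move=> /subsetP h; apply/ffunP => i; rewrite !ffunE; case: ifP => // /negP iJ.
by case ki : (k i) => [z|] //; case: iJ; apply: h; rewrite inE ki.
Qed.

Lemma sub_dom (A : eqType) (e e' : {ffun V -> option A}) : sub e e' -> dom e \subset dom e'.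
Proof.
move=> /forallP h; apply/subsetP => i; rewrite !inE; have := h i.
by case: (e i) => [z|] //= /eqP ->.
Qed.

Lemma sub_card_eq (A : eqType) (e e' : {ffun V -> option A}) :
  sub e e' -> (#|dom e'| <= #|dom e|)%N -> e = e'.
Proof.
move=> h c; have /eqP d : dom e == dom e' by rewrite eqEcard sub_dom.
apply/ffunP => i; have := forallP h i; have : (i \in dom e) = (i \in dom e') by rewrite d.
by rewrite !inE; case: (e i) => [z|]; case: (e' i) => [z'|] //= _ /eqP.
Qed.

(* Position [0] of a part holds the probed vertex, positions [1] to [N] the
   sample, and larger positions any further vertices. *)
Definition pedge := {ffun V -> option nat}.

Definition std (J : {set V}) : pedge := [ffun i => if i \in J then Some 0%N else None].

Lemma dom_std (J : {set V}) : dom (std J) = J.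
Proof. by apply/setP => i; rewrite !inE ffunE; case: (i \in J). Qed.

Lemma rst_std (I J : {set V}) : rst (std I) J = std (J :&: I).
Proof. by apply/ffunP => i; rewrite !ffunE inE; case: (i \in J). Qed.

(** The vertices of [e] have priority. An entry [x] of [s] stands for position [x.+1], as position 0
    is the probed vertex; in [lift] the entries are the positions themselves. *)
Definition join N (e : pedge) (s : {ffun V -> option 'I_N}) : pedge :=
  [ffun i => if e i is Some z then Some z else omap (fun x : 'I_N => x.+1) (s i)].

Definition lift N (s : {ffun V -> option 'I_N}) : pedge :=
  [ffun i => omap (@nat_of_ord N) (s i)].

Definition within N n (s : {ffun V -> option 'I_N}) : bool :=
  [forall i, if s i is Some x then (x < n)%N else true].

Definition narrow N n (s : {ffun V -> option 'I_N}) : {ffun V -> option 'I_n} :=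
  [ffun i => obind (fun x : 'I_N => insub (val x)) (s i)].

Definition bounded N (e : pedge) : bool :=
  [forall i, if e i is Some z then (z <= N)%N else true].

Lemma bounded_lift N (e : pedge) : bounded N e ->
  exists s : {ffun V -> option 'I_N.+1}, lift s = e.
Proof.
move=> /forallP h; exists [ffun i => omap inord (e i)]; apply/ffunP => i.
by rewrite !ffunE; have := h i; case: (e i) => [z|] //= zN; rewrite inordK.
Qed.

(** The transposition of 0 and [p]; [mv] applies it in each part to bring a face to the probed
    position. *)
Definition swp (p z : nat) : nat := if z == 0%N then p else if z == p then 0%N else z.

Definition mv (p : V -> nat) (e : pedge) : pedge := [ffun i => omap (swp (p i)) (e i)].

Section Colorings.
Variables (C : finType) (c0 : C).

Definition blkT N := {ffun {ffun V -> option 'I_N} -> C}.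

(** Only the first [n] samples are used, while the type is sized by [N], so that blocks with
    different sample sizes can share a type. *)
Definition blk N n (e : pedge) (x : pedge -> C) : blkT N :=
  [ffun s => if within n s then x (join e s) else c0].

(* Everything seen on [std J] and the sample, except on edges containing
   [std J]. *)
Definition bnd N (J : {set V}) (x : pedge -> C) : blkT N.+1 :=
  [ffun s => if [set i | lift s i == Some 0%N] \proper J then x (lift s) else c0].

Definition ext n N (u : blkT n) : blkT N :=
  [ffun s => if within n s then u (narrow n s) else c0].

Lemma blk_ext n N e x : blk N n e x = ext N (blk n n e x).
Proof.
apply/ffunP => s; rewrite !ffunE; case: ifP => // /forallP h; case: ifP.
  move=> _; congr (x _); apply/ffunP => i; rewrite !ffunE.
  case: (e i) => // ; have := h i; case: (s i) => [y|] //= yn.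
  by rewrite insubT.
by case/negP; apply/forallP => i; case: (narrow n s i).
Qed.

Definition cut n N M (u : blkT N) : blkT M :=
  [ffun s => if within n s then u (narrow N s) else c0].

Lemma cut_blk n m N M e x : (m <= n)%N -> (m <= N)%N ->
  cut m M (blk N n e x) = blk M m e x.
Proof.
move=> mn mN; apply/ffunP => s; rewrite !ffunE; case: ifP => // /forallP h.
rewrite ifT; last first.
  apply/forallP => i; rewrite ffunE; have := h i; case: (s i) => [y|] //= ym.
  by case: insubP => [z _ ->|] //; rewrite (leq_trans ym mn).
congr (x _); apply/ffunP => i; rewrite !ffunE; case: (e i) => //.
have := h i; case: (s i) => [y|] //= ym.
by rewrite insubT // (leq_trans ym mN).
Qed.

Lemma bnd_eq N J x x' : bnd N J x = bnd N J x' ->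
  forall e, bounded N e -> [set i | e i == Some 0%N] \proper J -> x e = x' e.
Proof.
move=> h e /bounded_lift[s es]; move/ffunP/(_ s) : h; rewrite !ffunE es.
by move=> + eJ; rewrite eJ.
Qed.

Lemma bnd_fac N N' J x x' : (N <= N')%N -> bnd N' J x = bnd N' J x' ->
  bnd N J x = bnd N J x'.
Proof.
move=> NN h; apply/ffunP => s; rewrite !ffunE; case: ifP => // sJ.
apply: (bnd_eq h) => //; apply/forallP => i; rewrite ffunE.
by case: (s i) => [y|] //=; apply: leq_trans NN; rewrite -ltnS.
Qed.

Lemma blk_std_fac N n M (J J' : {set V}) x x' : (N <= M)%N -> J' \proper J ->
  bnd M J x = bnd M J x' -> blk N n (std J') x = blk N n (std J') x'.
Proof.
move=> NM JJ h; apply/ffunP => s; rewrite !ffunE; case: ifP => // _.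
apply: (bnd_eq h).
  apply/forallP => i; rewrite !ffunE; case: (i \in J') => //.
  by case: (s i) => [y|] //=; apply: leq_trans NM.
suff -> : [set i | join (std J') s i == Some 0%N] = J' by [].
apply/setP => i; rewrite !inE !ffunE; case: (i \in J') => //.
by case: (s i).
Qed.

(** A face whose probed vertices form [std J'] is this face joined to samples, hence its color is
    recorded in the block of [J']. *)
Lemma bnd_blk_fac M (n : {set V} -> nat) N (J : {set V}) x x' : (M <= N)%N ->
  (forall J' : {set V}, J' \proper J -> (M <= n J')%N /\
     blk N (n J') (std J') x = blk N (n J') (std J') x') ->
  bnd M J x = bnd M J x'.
Proof.
move=> MN h; apply/ffunP => s; rewrite !ffunE; case: ifP => // sJ.
have [Mn /ffunP] := h _ sJ; set J' := [set i | _] in sJ Mn *.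
(* Entries 0 are dropped, since [std J'] supplies them; the others are lowered by one to undo the
   shift in [join]. *)
pose s' : {ffun V -> option 'I_N} :=
  [ffun i => if s i is Some y then if val y is z.+1 then insub z else None else None].
have w' : within (n J') s'.
  apply/forallP => i; rewrite ffunE; case: (s i) => [[[|z] zM]|] //=.
  by case: insubP => //= y _ ->; apply: leq_trans Mn.
suff e : join (std J') s' = lift s by move=> /(_ s'); rewrite !ffunE w' e.
apply/ffunP => i; rewrite !ffunE !inE !ffunE; case: (s i) => [[[|z] zM]|] //=.
by rewrite insubT //; apply: leq_trans MN.
Qed.

End Colorings.
End Faces.

(** * Regularity and the Bayesian network *)

Section World.
Variables (R : realType) (V C : finType) (c0 : C).
Variables (Psi : finType) (w : Psi -> R) (X : Psi -> pedge V -> C).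
Hypothesis w_ge0 : forall x, 0 <= w x.
Hypothesis w_sum : \sum_x w x = 1.
Implicit Types J : {set V}.

Section Level.
Variables (lev : nat -> nat) (N : nat).

(** The block in its native type; [yst] is the same block in a type common to all faces. Regularity
    refers to the native type, whose size is known before [N] is chosen. *)
Definition nblk (J : {set V}) x := blk c0 (lev #|J|) (lev #|J|) (std J) (X x).

Definition yst (J : {set V}) x : blkT V C N := blk c0 N (lev #|J|) (std J) (X x).

Definition bdry (J : {set V}) (z : {set V} -> blkT V C N) : {ffun {set V} -> blkT V C N} :=
  [ffun J' : {set V} => if J' \proper J then z J' else [ffun=> c0]].

Definition ybdry (J : {set V}) x := bdry J (yst^~ x).

Definition bmass (J : {set V}) (z : {set V} -> blkT V C N) : R :=
  mean w (fun x => (ybdry J x == bdry J z)%:R).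

(* The conditional law of a block given the blocks of its proper subfaces, with
   an arbitrary value when the condition has probability [0]. *)
Definition kappa (J : {set V}) (z : {set V} -> blkT V C N) (v : blkT V C N) : R :=
  if bmass J z == 0 then (v == [ffun=> c0])%:R else
  mean w (fun x => (ybdry J x == bdry J z)%:R * (yst J x == v)%:R) / bmass J z.

(** Showing [N1] samples on the boundary, instead of the number used for the largest proper
    subfaces, hardly raises the energy of a block. The tolerance is divided by the number of blocks
    so that the errors over all blocks add up to [d]. *)
Definition regular d N1 := forall (J : {set V}) (t : blkT V C (lev #|J|)),
  energy w (fun x => bnd c0 N1 J (X x)) (fun x => (nblk J x == t)%:R) <=
  energy w (fun x => bnd c0 (lev #|J|.-1) J (X x)) (fun x => (nblk J x == t)%:R)
   + (d / #|{: blkT V C (lev #|J|)}|%:R) ^+ 2.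

Lemma kappa_ge0 J z v : 0 <= kappa J z v.
Proof.
rewrite /kappa; case: ifP => // _; rewrite divr_ge0 // mean_ge0 // => x.
by rewrite mulr_ge0.
Qed.

Lemma kappa_sum J z : \sum_v kappa J z v = 1.
Proof.
rewrite /kappa; have [_|d0] := eqVneq (bmass J z) 0.
  by rewrite (bigD1 [ffun=> c0]) //= eqxx big1 ?addr0 // => v /negPf ->.
rewrite -big_distrl /= -[RHS](divff d0) -mean_sum; congr (_ / _).
apply: eq_mean => x; rewrite -big_distrr /= (bigD1 (yst J x)) //= eqxx.
by rewrite big1 ?addr0 ?mulr1 // => v /negPf nv; rewrite eq_sym nv.
Qed.

Lemma kappa_ext (J : {set V}) z z' v : (forall J' : {set V}, J' \proper J -> z J' = z' J') ->
  kappa J z v = kappa J z' v.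
Proof.
move=> h; rewrite /kappa /bmass (_ : bdry J z = bdry J z') //.
by apply/ffunP => J'; rewrite !ffunE; case: ifP => // /h.
Qed.

Lemma kappa_cexp J x v : w x != 0 ->
  kappa J (yst^~ x) v = cexp w (ybdry J) (fun x' => (yst J x' == v)%:R) x.
Proof.
move=> wx; rewrite /kappa /bmass -/(ybdry J x) ifF //; apply/negbTE.
by apply: contra wx => /eqP/(mean_class_eq0 w_ge0)/eqP.
Qed.

(** Regularity is known for [Y] in [T], the conclusion concerns [h \o Y] in a possibly much larger
    [U]. Grouping by the fibres of [h] turns the sum over [U] into one over [T], so the error does
    not see the size of [U]. *)
Lemma mean_sum_dual (T2 : eqType) (Z2 : Psi -> T2) (T3 : eqType) (Z3 : Psi -> T3)
    (T U : finType) (Y : Psi -> T) (h : T -> U) (g : U -> Psi -> R) d :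
  (forall x x', Z3 x = Z3 x' -> Z2 x = Z2 x') -> 0 <= d ->
  (forall t, energy w Z3 (fun x => (Y x == t)%:R) <=
             energy w Z2 (fun x => (Y x == t)%:R) + (d / #|T|%:R) ^+ 2) ->
  (forall u x x', Z3 x = Z3 x' -> g u x = g u x') -> (forall u x, `|g u x| <= 1) ->
  `|mean w (fun x => \sum_u ((h (Y x) == u)%:R - cexp w Z2 (fun x' => (h (Y x') == u)%:R) x) * g u x)| <= d.
Proof.
move=> Z23 d0 hd gZ g1.
have ind u x : (h (Y x) == u)%:R = \sum_(t | h t == u) (Y x == t)%:R :> R.
  case: eqP => [<-|n].
    rewrite (bigD1 (Y x)) //= eqxx big1 ?addr0 // => t /andP[_ /negPf nt].
    by rewrite eq_sym nt.
  by rewrite big1 // => t /eqP ht; case: eqP => // yt; case: n; rewrite yt.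
have e x : \sum_u ((h (Y x) == u)%:R - cexp w Z2 (fun x' => (h (Y x') == u)%:R) x) * g u x =
   \sum_t ((Y x == t)%:R - cexp w Z2 (fun x' => (Y x' == t)%:R) x) * g (h t) x.
  rewrite [RHS](partition_big h predT) //=; apply: eq_bigr => u _.
  rewrite (eq_cexp (Z' := Z2) (g := fun x => \sum_(t | h t == u) (Y x == t)%:R) _ (fun=> erefl)) //.
  rewrite cexp_sum ind -sumrB big_distrl /=.
  by apply: eq_bigr => t /eqP ->.
rewrite (eq_mean _ e) mean_sum; apply: le_trans (ler_norm_sum _ _ _) _.
apply: le_trans (_ : \sum_(t : T) d / #|T|%:R <= d).
  apply: ler_sum => t _.
  apply: (mean_cexp_dual w_ge0 w_sum Z23 _ (hd t) (gZ (h t)) (g1 (h t))).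
  by rewrite divr_ge0.
rewrite sumr_const -[X in X <= _]mulr_natr.
have [->|T0] := eqVneq #|T| 0%N; first by rewrite mulr0.
by rewrite divfK // pnatr_eq0.
Qed.

(** The sign of the difference of the two conditional expectations, as test function in
    [mean_sum_dual], produces the norm. *)
Lemma mean_sum_norm (T2 : eqType) (Z2 : Psi -> T2) (T3 : eqType) (Z3 : Psi -> T3)
    (T U : finType) (Y : Psi -> T) (h : T -> U) d :
  (forall x x', Z3 x = Z3 x' -> Z2 x = Z2 x') -> 0 <= d ->
  (forall t, energy w Z3 (fun x => (Y x == t)%:R) <=
             energy w Z2 (fun x => (Y x == t)%:R) + (d / #|T|%:R) ^+ 2) ->
  mean w (fun x => \sum_u `|cexp w Z3 (fun x' => (h (Y x') == u)%:R) x -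
                   cexp w Z2 (fun x' => (h (Y x') == u)%:R) x|) <= d.
Proof.
move=> Z23 d0 hd.
pose sg (u : U) x : R := Num.sg (cexp w Z3 (fun x' => (h (Y x') == u)%:R) x -
                   cexp w Z2 (fun x' => (h (Y x') == u)%:R) x).
have sgZ u x x' : Z3 x = Z3 x' -> sg u x = sg u x'.
  move=> e; rewrite /sg (cexp_fac w _ e); congr (Num.sg (_ - _)).
  by apply: cexp_fac; apply: Z23.
have sg1 u x : `|sg u x| <= 1 by rewrite /sg normr_sg; case: (_ == _).
have := mean_sum_dual h Z23 d0 hd sgZ sg1.
apply: le_trans; apply: le_trans (ler_norm _).
rewrite !mean_sum; apply: ler_sum => u _.
rewrite (eq_mean w (fun x => mulrBl (sg u x) ((h (Y x) == u)%:R) _)) meanB.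
rewrite -(mean_cexpM w_ge0 _ (sgZ u)) -meanB; apply: ler_mean => // x.
by rewrite -mulrBl mulrC /sg -normrEsg.
Qed.

Hypothesis lev_le : forall i j, (i <= j)%N -> (lev j <= lev i)%N.
Hypothesis levN : forall j, (lev j <= N)%N.

Section Reg.
Variables (d : R) (N1 : nat).
Hypothesis d_ge0 : 0 <= d.
Hypothesis N1N : (N < N1)%N.
Hypothesis reg : regular d N1.

Lemma levP J' J : J' \proper J -> (lev #|J|.-1 <= lev #|J'|)%N.
Proof.
move=> /proper_card h; apply: lev_le; case: #|J| h => // n.
Qed.

Lemma ybdry_fac J x x' : bnd c0 N1 J (X x) = bnd c0 N1 J (X x') -> ybdry J x = ybdry J x'.
Proof.
move=> h; apply/ffunP => J'; rewrite !ffunE; case: ifP => // JJ.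
by apply: blk_std_fac h => //; apply: ltnW.
Qed.

Lemma bnd_ybdry J x x' : ybdry J x = ybdry J x' ->
  bnd c0 (lev #|J|.-1) J (X x) = bnd c0 (lev #|J|.-1) J (X x').
Proof.
move=> h; apply: (@bnd_blk_fac _ _ _ _ (fun J' => lev #|J'|) N) => // J' JJ.
split; first exact: levP.
by move/ffunP/(_ J') : h; rewrite !ffunE JJ.
Qed.

(** By monotonicity, the gap in [regular] passes to any [Z2] at least as fine as the small boundary
    and any [Z3] at most as fine as the large one. The blocks of the proper subfaces lie between the
    two, because [lev] is decreasing. *)
Lemma energy_gap J (t : blkT V C (lev #|J|)) (T2 T3 : eqType) (Z2 : Psi -> T2) (Z3 : Psi -> T3) :
  (forall x x', Z2 x = Z2 x' ->
      bnd c0 (lev #|J|.-1) J (X x) = bnd c0 (lev #|J|.-1) J (X x')) ->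
  (forall x x', bnd c0 N1 J (X x) = bnd c0 N1 J (X x') -> Z3 x = Z3 x') ->
  energy w Z3 (fun x => (nblk J x == t)%:R) <=
  energy w Z2 (fun x => (nblk J x == t)%:R) + (d / #|{: blkT V C (lev #|J|)}|%:R) ^+ 2.
Proof.
move=> h2 h3; apply: le_trans (energy_mono w_ge0 h3 _) _.
apply: le_trans (reg t) _; rewrite lerD2r; exact: energy_mono.
Qed.

(** This is [mean_sum_dual] with the blocks of the proper subfaces as [Z2] and the whole boundary at
    [N1] as [Z3]; at points of positive weight the conditional expectation is [kappa]. *)
Lemma reg_std J (F : blkT V C N -> Psi -> R) :
  (forall v x x', bnd c0 N1 J (X x) = bnd c0 N1 J (X x') -> F v x = F v x') ->
  (forall v x, `|F v x| <= 1) ->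
  `|mean w (fun x => \sum_v ((yst J x == v)%:R - kappa J (yst^~ x) v) * F v x)| <= d.
Proof.
move=> FZ F1.
have := @mean_sum_dual _ (ybdry J) _ (fun x => bnd c0 N1 J (X x)) _ _
   (nblk J) (@ext _ _ c0 _ N) F d (@ybdry_fac J) d_ge0.
move=> /(_ (fun t => energy_gap t (@bnd_ybdry J) (fun _ _ => id)) FZ F1).
congr (`| _ | <= _); apply: eq_bigr => x _.
have [->|wx] := eqVneq (w x) 0; first by rewrite !mul0r.
congr (_ * _); apply: eq_bigr => v _; rewrite kappa_cexp //.
have e x' : ext c0 N (nblk J x') = yst J x' by rewrite /nblk -blk_ext.
congr ((_ - _) * _); first by rewrite e.
by apply: eq_cexp => // x'; rewrite e.
Qed.


Hypothesis sym : forall p : V -> nat, (forall i, p i <= N1)%N ->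
  forall Th : (pedge V -> C) -> R,
  mean w (fun x => Th (X x)) = mean w (fun x => Th (fun e => X x (mv p e))).

Variable Nm : nat.
Hypothesis NNm : (N <= Nm)%N.
Hypothesis NmN1 : (Nm < N1)%N.

(** The positions 1 to [N] are reserved for the sample. *)
Definition placed (e : pedge V) :=
  forall i z, e i = Some z -> ((z == 0%N) || (N < z)%N) && (z <= Nm)%N.

(* The swap moving [e] to the position [0] moves every other vertex to a
   position between [1] and [N1], where it is one more sample. *)
Lemma reg_face (e : pedge V) (F : (pedge V -> C) -> blkT V C N -> R) :
  placed e ->
  (forall v x x', (forall e', bounded Nm e' -> ~~ sub e e' -> x e' = x' e') -> F x v = F x' v) ->
  (forall v x, `|F x v| <= 1) ->
  `|mean w (fun x => \sum_v ((blk c0 N (lev #|dom e|) e (X x) == v)%:R -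
     kappa (dom e) (fun J => blk c0 N (lev #|J|) (rst e J) (X x)) v) * F (X x) v)| <= d.
Proof.
move=> pe FZ F1; set J := dom e.
(* In parts missed by [e] the probed position is exchanged with [N1], which exceeds [Nm]; so no
   vertex of a face bounded by [Nm] is moved to 0 there. *)
pose p i := odflt N1 (e i).
have pN i : (p i <= N1)%N.
  rewrite /p; case ei : (e i) => [z|] //=.
  by have /andP[_ h] := pe _ _ ei; apply: leq_trans h (ltnW NmN1).
pose G x v := F (fun e => X x (mv p e)) v.
(* The samples stay in place, since [p i] is 0 or larger than [N]. *)
have hs J' (s : {ffun V -> option 'I_N}) : J' \subset J ->
    mv p (join (rst e J') s) = join (std J') s.
  move=> JJ; apply/ffunP => i; rewrite !ffunE /p /swp.
  have [iJ|iJ] := boolP (i \in J').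
    by have := fintype.subsetP JJ i iJ; rewrite inE; case: (e i) => [z|] //= _; case: eqP => [->|]; rewrite ?eqxx.
  case: (s i) => [y|] //=; case ei : (e i) => [z|] /=.
    have /andP[hz _] := pe _ _ ei; have yN := ltn_ord y.
    by rewrite ifF //; apply/eqP; lia.
  by have yN := ltn_ord y; rewrite ifF //; apply/eqP; lia.
have hb x J' n : J' \subset J ->
    blk c0 N n (rst e J') (fun e => X x (mv p e)) = blk c0 N n (std J') (X x).
  by move=> JJ; apply/ffunP => s; rewrite !ffunE hs.
have := @reg_std J (fun v x => G x v).
move=> h; apply: le_trans (h _ _) => {h}; first last.
- by move=> v x; apply: F1.
- move=> v x x' h; apply: FZ => e' be' se'; apply: (bnd_eq h).
    apply/forallP => i; rewrite ffunE; have := forallP be' i.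
    case: (e' i) => [z|] //= zN; rewrite /swp; case: eqP => [_|_]; first exact: pN.
    by case: eqP => // _; apply: leq_trans zN (ltnW NmN1).
  (* After the move, [e'] has its probed vertices exactly where it agrees with [e]. If it does not
     contain [e], these parts form a proper subset of [J], so [bnd] records it. *)
  have e0 i : (mv p e' i == Some 0%N) = (i \in J) && (e' i == e i).
    rewrite ffunE /p inE /swp; have := forallP be' i.
    case: (e' i) => [z|] /= zN; case ei : (e i) => [y|] //=.
      rewrite !(inj_eq Some_inj); have [->|z0] := eqVneq z 0%N; first exact: eq_sym.
      by case: (z == y) => //; apply/negbTE.
    rewrite (inj_eq Some_inj); have [_|z0] := eqVneq z 0%N; first by apply/eqP; lia.
    by rewrite ifF; [apply/negbTE|apply/eqP; lia].
  rewrite properEneq; apply/andP; split.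
    apply: contra se' => /eqP eJ; apply/forallP => i.
    have : (i \in J) = (i \in [set i | mv p e' i == Some 0%N]) by rewrite eJ.
    rewrite [X in _ = X]inE e0 inE; case: (e i) => [y|] //=.
  by apply/fintype.subsetP => i; rewrite inE e0 => /andP[].
rewrite le_eqVlt; apply/orP; left; apply/eqP; congr (`| _ |).
apply: etrans (sym pN (fun y => \sum_v ((blk c0 N (lev #|J|) e y == v)%:R -
  kappa J (fun J => blk c0 N (lev #|J|) (rst e J) y) v) * F y v)) _.
apply: eq_mean => x; apply: eq_bigr => v _; congr ((_ - _) * _).
  by rewrite -{1}(rst_id (fintype.subxx (dom e))) hb.
by apply: kappa_ext => J' JJ; rewrite hb // proper_sub.
Qed.

Section Net.
Variables (K : eqType) (pe : K -> pedge V) (rs : K -> {set V} -> K).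
Hypothesis pe_rs : forall k J, pe (rs k J) = rst (pe k) J.

Definition nker (k : K) (y : K -> blkT V C N) v := kappa (dom (pe k)) (fun J => y (rs k J)) v.

Definition nval (k : K) x : blkT V C N := blk c0 N (lev #|dom (pe k)|) (pe k) (X x).

(** The second condition keeps every face containing [k] out of the earlier list: regularity
    controls the block of [k] only against faces that do not contain it. *)
Definition topological (l : seq K) := forall l1 k l2, l = l1 ++ k :: l2 ->
  (forall J, J \proper dom (pe k) -> rs k J \in l1) /\
  (forall k', k' \in l1 -> ~~ sub (pe k) (pe k')).

Variable l : seq K.
Hypothesis l_topo : topological l.
Hypothesis l_placed : forall k, k \in l -> placed (pe k).

Lemma sub_join (e e' : pedge V) (s : {ffun V -> option 'I_N}) :
  placed e -> sub e (join e' s) -> sub e e'.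
Proof.
move=> pe0 /forallP h; apply/forallP => i; have := h i; rewrite ffunE.
case ei : (e i) => [z|] //=; case: (e' i) => [z'|] //; case: (s i) => [y|] //=.
move=> /eqP[yz]; have /andP[] := pe0 _ _ ei; rewrite -yz /=.
by move/(leq_trans (ltn_ord y)); rewrite ltnn.
Qed.

(** The earlier blocks read faces [pe k'] joined to samples, and by [sub_join] none of these
    contains [pe k]. So the earlier blocks can be absorbed into the test function of [reg_face]. *)
Lemma net_step l1 k l2 y0 (G : (K -> blkT V C N) -> blkT V C N -> R) :
  l = l1 ++ k :: l2 -> (forall y v, `|G y v| <= 1) ->
  `|mean w (fun x => \sum_v ((nval k x == v)%:R - nker k (seen nval l1 y0 x) v) *
      G (seen nval l1 y0 x) v)| <= d.
Proof.
move=> el G1; have [hrs hsub] := l_topo el.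
have kl : k \in l by rewrite el mem_cat inE eqxx orbT.
pose F x v := G (fun k' => if k' \in l1 then blk c0 N (lev #|dom (pe k')|) (pe k') x else y0 k') v.
have := @reg_face (pe k) F (l_placed kl).
move=> h; apply: le_trans (h _ _) => {h}; first last.
- by move=> v x; apply: G1.
- move=> v x x' h; congr (G _ v); apply: funext => k'; case: ifP => // k'l.
  apply/ffunP => s; rewrite !ffunE; case: ifP => // _; apply: h.
    apply/forallP => i; rewrite ffunE; case ei : (pe k' i) => [z|].
      have : k' \in l by rewrite el mem_cat k'l.
      by move=> /l_placed/(_ _ _ ei)/andP[].
    by case: (s i) => [y|] //=; apply: leq_trans NNm.
  by apply: contra (hsub _ k'l); apply: sub_join; apply: l_placed.
rewrite le_eqVlt; apply/orP; left; apply/eqP; congr (`| _ |).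
apply: eq_mean => x; apply: eq_bigr => v _; congr ((_ - _) * _).
apply: kappa_ext => J JJ; rewrite /seen hrs // /nval pe_rs dom_rst.
by rewrite (setIidPl (proper_sub JJ)).
Qed.

Lemma net_hybrid (f : (K -> blkT V C N) -> R) y0 : (forall y, `|f y| <= 1) ->
  `|mean w (fun x => f (seen nval l y0 x)) - proc nker l f y0|
    <= (size l)%:R * d.
Proof.
move=> f1; apply: hybrid => //.
- by move=> *; apply: kappa_ge0.
- by move=> *; apply: kappa_sum.
by move=> l1 k l2 el G G1; exact: (net_step y0 el G1).
Qed.

End Net.
End Reg.
End Level.
End World.

(** * Redrawing given coarse blocks *)

Section Refresh.
Variables (R : realType) (A B : finType) (theta : R) (cs : B -> A).
Hypothesis theta_gt0 : 0 < theta.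

Definition cmass (q : B -> R) (u : A) : R := \sum_(v | cs v == u) q v.

(** Conditioning of [q] on the coarse value [u], given up when [u] has mass below [theta]; the
    cutoff keeps the density against [q] bounded. *)
Definition refresh (q : B -> R) (u : A) (v : B) : R :=
  if theta <= cmass q u then (cs v == u)%:R * q v / cmass q u else q v.

Variable q : B -> R.
Hypothesis q_ge0 : forall v, 0 <= q v.
Hypothesis q_sum : \sum_v q v = 1.

Lemma cmass_ge0 u : 0 <= cmass q u.
Proof. by apply: sumr_ge0. Qed.

Lemma refresh_ge0 u v : 0 <= refresh q u v.
Proof.
rewrite /refresh; case: ifP => // _.
by rewrite divr_ge0 ?cmass_ge0 // mulr_ge0.
Qed.

Lemma refresh_sum u : \sum_v refresh q u v = 1.
Proof.
rewrite /refresh; have [h|//] := leP theta (cmass q u); rewrite -big_distrl /=.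
rewrite (_ : \sum_v _ = cmass q u) ?divff //; first by rewrite gt_eqF // (lt_le_trans theta_gt0).
rewrite /cmass [RHS]big_mkcond /=; apply: eq_bigr => v _.
by case: ifP; rewrite ?mul1r ?mul0r.
Qed.

Lemma refresh_le u v : theta <= 1 -> refresh q u v <= theta^-1 * q v.
Proof.
move=> t1; rewrite /refresh; case: ifP => h; last first.
  by rewrite ler_peMl // invf_ge1.
have q0 : 0 < cmass q u by apply: lt_le_trans h.
rewrite mulrC ler_pM ?invr_ge0 ?(ltW q0) ?mulr_ge0 //.
  by rewrite lef_pV2.
by case: (_ == _); rewrite ?mul1r ?mul0r.
Qed.

(** A draw from [q] is compared with a coarse draw from [p] followed by a refresh. For a likely [u]
    the two contributions differ by the factor [cmass q u - p u]; for an unlikely [u] they are at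
    most [cmass q u] and [p u], which costs an extra [2 * theta]. *)
Lemma refresh_err (p : A -> R) (G : A -> B -> R) :
  (forall u, 0 <= p u) -> (forall u v, `|G u v| <= 1) ->
  `|\sum_v q v * G (cs v) v - \sum_u \sum_v p u * refresh q u v * G u v| <=
  \sum_u `|cmass q u - p u| + 2 * theta * #|A|%:R.
Proof.
move=> p0 G1.
rewrite (partition_big cs predT) //= -sumrB.
apply: le_trans (ler_norm_sum _ _ _) _.
rewrite mulr_natr -sumr_const -big_split /=; apply: ler_sum => u _.
pose b := \sum_v refresh q u v * G u v.
have b1 : `|b| <= 1.
  apply: le_trans (ler_norm_sum _ _ _) _; rewrite -[X in _ <= X](refresh_sum u).
  apply: ler_sum => v _; rewrite normrM (ger0_norm (refresh_ge0 _ _)).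
  by rewrite ler_piMr // refresh_ge0.
rewrite (_ : \sum_v p u * refresh q u v * G u v = p u * b); last first.
  by rewrite /b big_distrr /=; apply: eq_bigr => v _; rewrite mulrA.
have [good|bad] := leP theta (cmass q u).
  rewrite (_ : \sum_(v | _) _ = cmass q u * b); last first.
    rewrite /b big_distrr /= big_mkcond /=; apply: eq_bigr => v _.
    rewrite /refresh good; case: eqP => [->|_]; last by rewrite !mul0r mulr0.
    by rewrite mul1r mulrA mulrCA divff ?mulr1 // gt_eqF // (lt_le_trans theta_gt0).
  rewrite -mulrBl normrM; apply: (@le_trans _ _ `|cmass q u - p u|).
    by rewrite ler_piMr.
  by rewrite lerDl mulr_ge0 // ltW.
have h1 : `|\sum_(v | cs v == u) q v * G (cs v) v| <= cmass q u.
  apply: le_trans (ler_norm_sum _ _ _) _; apply: ler_sum => v _.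
  by rewrite normrM (ger0_norm (q_ge0 v)) ler_piMr.
have h2 : `|p u * b| <= p u by rewrite normrM (ger0_norm (p0 u)) ler_piMr.
have h3 := ler_norm (p u - cmass q u); rewrite distrC in h3.
apply: le_trans (ler_normB _ _) _; lra.
Qed.

End Refresh.

Section Coarse.
Variables (R : realType) (V C : finType) (c0 : C).
Variables (Psi : finType) (w : Psi -> R) (X : Psi -> pedge V -> C).
Hypothesis w_ge0 : forall x, 0 <= w x.
Hypothesis w_sum : \sum_x w x = 1.
Implicit Types J : {set V}.
Variables (lev lev' : nat -> nat) (M N N1 : nat) (d0 d1 theta : R).
Hypothesis lev_le : forall i j, (i <= j)%N -> (lev j <= lev i)%N.
Hypothesis levM : forall j, (lev j <= M)%N.
Hypothesis lev'_le : forall i j, (i <= j)%N -> (lev' j <= lev' i)%N.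
Hypothesis lev'N : forall j, (lev' j <= N)%N.
Hypothesis M_lev' : forall j, (M <= lev' j)%N.
Hypothesis N_N1 : (N < N1)%N.
Hypothesis d0_ge0 : 0 <= d0.
Hypothesis d1_ge0 : 0 <= d1.
Hypothesis reg0 : regular c0 w X lev d0 N1.
Hypothesis reg1 : regular c0 w X lev' d1 N1.
Hypothesis sym : forall p : V -> nat, (forall i, p i <= N1)%N ->
  forall Th : (pedge V -> C) -> R,
  mean w (fun x => Th (X x)) = mean w (fun x => Th (fun e => X x (mv p e))).
Hypothesis theta_gt0 : 0 < theta.

Let A := blkT V C M.
Let B := blkT V C N.
Let Y0 J x : A := yst c0 X lev M J x.
Let Y1 J x : B := yst c0 X lev' N J x.
Let kA J (z : {set V} -> A) u : R := kappa c0 w X lev J z u.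
Let kB J (z : {set V} -> B) v : R := kappa c0 w X lev' J z v.
Let cs J (v : B) : A := cut c0 (lev #|J|) M v.

Definition rker J (u : blkT V C M) (z : {set V} -> blkT V C N) (v : blkT V C N) : R :=
  refresh theta (cut c0 (lev #|J|) M) (kappa c0 w X lev' J z) u v.

Lemma MN : (M <= N)%N.
Proof. exact: leq_trans (M_lev' 0) (lev'N 0). Qed.

Lemma cs_Y1 J x : cs J (Y1 J x) = Y0 J x.
Proof.
rewrite /cs /Y1 /yst cut_blk // ?(leq_trans (levM _)) //.
exact: MN.
Qed.

(** The coarse marginal of the fine conditional law is the law of the coarse block given the fine
    boundary. Coarse regularity bounds its distance from the law given the coarse boundary, as the
    fine boundary is still determined by [bnd] at [N1]. *)
Lemma coarse_gap J :
  mean w (fun x => \sum_u `|cmass (cs J) (kB J (Y1^~ x)) u - kA J (Y0^~ x) u|) <= d0.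
Proof.
have := @mean_sum_norm R Psi w w_ge0 w_sum _ (ybdry c0 X lev M J) _ (ybdry c0 X lev' N J) _ _
   (nblk c0 X lev J) (@ext _ _ c0 _ M) d0.
move=> h; apply: le_trans (h _ d0_ge0 _) => {h}.
- rewrite le_eqVlt; apply/orP; left; apply/eqP; apply: eq_bigr => x _.
  have [->|wx] := eqVneq (w x) 0; first by rewrite !mul0r.
  congr (_ * _); apply: eq_bigr => u _.
  have e x' : ext c0 M (nblk c0 X lev J x') = Y0 J x' by rewrite /nblk -blk_ext.
  congr (`| _ - _ |); last first.
    by rewrite /kA kappa_cexp //; apply: eq_cexp => // x'; rewrite e.
  rewrite /cmass (eq_cexp (Z' := ybdry c0 X lev' N J) (g := fun x => \sum_(v | cs J v == u) (Y1 J x == v)%:R) _ _) //.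
    by rewrite cexp_sum; apply: eq_bigr => v _; rewrite /kB kappa_cexp.
  move=> x'; rewrite e -cs_Y1; case: eqP => [<-|n].
    rewrite (bigD1 (Y1 J x')) //= eqxx big1 ?addr0 // => t /andP[_ /negPf nt].
    by rewrite eq_sym nt.
  by rewrite big1 // => t /eqP ht; case: eqP => // yt; case: n; rewrite yt.
- move=> x x' h; apply/ffunP => J'; have /ffunP/(_ J') := h; rewrite !ffunE.
  by case: ifP => // _ e; rewrite -/(Y0 J' x) -/(Y0 J' x') -!cs_Y1 /Y1 e.
move=> t; apply: (energy_gap w_ge0 reg0) => x x'.
  exact: bnd_ybdry.
exact: ybdry_fac.
Qed.

Variable l : seq {set V}.
Hypothesis l_topo : forall l1 J l2, l = l1 ++ J :: l2 ->
  (forall J' : {set V}, J' \proper J -> J' \in l1) /\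
  (forall J' : {set V}, J' \in l1 -> ~~ (J \subset J')).
Hypothesis l_uniq : uniq l.
Hypothesis l_all : forall J, J \in l.

Let srs J J' : {set V} := J' :&: J.

Lemma std_srs J J' : std (srs J J') = rst (std J) J'.
Proof. by rewrite rst_std. Qed.

Lemma std_topological : topological (@std V) srs l.
Proof.
move=> l1 J l2 el; have [h1 h2] := l_topo el; split.
  move=> J'; rewrite dom_std => JJ; rewrite /srs (setIidPl (proper_sub JJ)).
  exact: h1.
by move=> J' /h2; apply: contra => /sub_dom; rewrite !dom_std.
Qed.

Lemma placed_std n J : placed n n (std J).
Proof. by move=> i z; rewrite ffunE; case: (i \in J) => // -[<-]. Qed.

Lemma nker_std n (lv : nat -> nat) J (z : {set V} -> blkT V C n) v :
  nker c0 w X lv (@std V) srs J z v = kappa c0 w X lv J z v.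
Proof.
rewrite /nker dom_std; apply: kappa_ext => J' /proper_sub JJ.
by rewrite /srs (setIidPl JJ).
Qed.

Lemma nval_std n (lv : nat -> nat) J x :
  nval c0 X lv n (@std V) J x = yst c0 X lv n J x.
Proof. by rewrite /nval dom_std. Qed.

Lemma coarse_net (f : ({set V} -> A) -> R) a0 : (forall a, `|f a| <= 1) ->
  `|mean w (fun x => f (Y0^~ x)) - proc kA l f a0| <= (size l)%:R * d0.
Proof.
move=> f1.
have MN1 := leq_ltn_trans MN N_N1.
have := net_hybrid w_ge0 w_sum lev_le levM d0_ge0 MN1 reg0 sym (leqnn M) MN1
  std_srs std_topological (fun k _ => @placed_std M k) a0 f1.
congr (`| _ - _ | <= _).
  apply: eq_mean => x; congr f; apply: funext => J.
  by rewrite /seen l_all nval_std.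
by congr (proc _ l f a0); apply: funext => J; apply: funext => z; apply: funext => v; exact: nker_std.
Qed.

(** By [proc_pair], the process can draw the coarse and the fine block of a face in the same step,
    after which [hybrid] compares it with the true pairs face by face. *)
Lemma pair_net (f : ({set V} -> A) -> ({set V} -> B) -> R) a0 y0 :
  (forall a y, `|f a y| <= 1) ->
  `|mean w (fun x => f (Y0^~ x) (Y1^~ x)) -
    proc kA l (fun a => proc (fun J => rker J (a J)) l (f a) y0) a0|
    <= (size l)%:R * (d1 + d0 + 2 * theta * #|A|%:R).
Proof.
move=> f1.
pose Yp J x := (Y0 J x, Y1 J x).
pose pk (e : {set V}) (z : {set V} -> A * B) (uv : A * B) : R :=
  kA e (fun e' => (z e').1) uv.1 * rker e uv.1 (fun e' => (z e').2) uv.2.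
pose fp (z : {set V} -> A * B) := f (fun e => (z e).1) (fun e => (z e).2).
pose z0 (e : {set V}) := (a0 e, y0 e).
have -> : proc kA l (fun a => proc (fun J => rker J (a J)) l (f a) y0) a0 = proc pk l fp z0.
  by rewrite -(proc_pair kA rker f a0 y0 l_uniq).
have kA0 J z u : 0 <= kA J z u by exact: kappa_ge0.
have kB0 J z u : 0 <= kB J z u by exact: kappa_ge0.
have kA1 J z : \sum_u kA J z u = 1 by exact: kappa_sum.
have kB1 J z : \sum_u kB J z u = 1 by exact: kappa_sum.
have pk0 e y v : 0 <= pk e y v by rewrite mulr_ge0 // refresh_ge0.
have pk1 e y : \sum_v pk e y v = 1.
  rewrite /pk -(pair_bigA _ (fun u v => kA e (fun e' => (y e').1) u * rker e u (fun e' => (y e').2) v)) /=.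
  rewrite -[RHS](kA1 e (fun e' => (y e').1)); apply: eq_bigr => u _.
  by rewrite -big_distrr /= refresh_sum ?mulr1.
have -> : mean w (fun x => f (Y0^~ x) (Y1^~ x)) = mean w (fun x => fp (seen Yp l z0 x)).
  by apply: eq_mean => x; rewrite /fp /seen; congr (f _ _); apply: funext => J; rewrite l_all.
apply: (hybrid pk0 pk1 w_sum) => [y|l1 J l2 el G G1]; first exact: f1.
have [hp hs] := l_topo el.
pose y1 x := seen Yp l1 z0 x.
have e1 x : kA J (fun e => (y1 x e).1) =1 kA J (Y0^~ x).
  by move=> u; apply: kappa_ext => J' /hp JJ; rewrite /y1 /seen JJ.
have e2 x : kB J (fun e => (y1 x e).2) =1 kB J (Y1^~ x).
  by move=> u; apply: kappa_ext => J' /hp JJ; rewrite /y1 /seen JJ.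
(* [T1] replaces the true fine block by a draw from its conditional law, at cost [d1]. [T2] replaces
   that draw by a coarse draw and a refresh, with the error of [refresh_err] and [coarse_gap]. *)
pose T1 x := \sum_v ((Y1 J x == v)%:R - kB J (Y1^~ x) v) * G (y1 x) (cs J v, v).
pose T2 x := \sum_v kB J (Y1^~ x) v * G (y1 x) (cs J v, v) -
  \sum_u \sum_v kA J (Y0^~ x) u * refresh theta (cs J) (kB J (Y1^~ x)) u v * G (y1 x) (u, v).
rewrite (eq_mean w (g := fun x => T1 x + T2 x)); last first.
  move=> x; rewrite /T1 /T2.
  under [X in _ = X + _]eq_bigr do rewrite mulrBl.
  rewrite sumrB addrA subrK.
  under eq_bigr do rewrite mulrBl.
  rewrite sumrB; congr (_ - _).
    rewrite (bigD1 (Yp J x)) //= eqxx big1 ?addr0; last by move=> v /negPf nv; rewrite eq_sym nv mul0r.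
    rewrite (bigD1 (Y1 J x)) //= eqxx big1 ?addr0; last by move=> v /negPf nv; rewrite eq_sym nv mul0r.
    by rewrite cs_Y1.
  rewrite pair_bigA /=; apply: eq_bigr => -[u v] _ /=; congr (_ * _ * _).
    exact: e1.
  by rewrite /rker; congr (refresh _ _ _ _ _); apply: funext => v'; exact: e2.
rewrite meanD.
apply: le_trans (ler_normD _ _) _; rewrite -addrA lerD //.
  (* Coarse blocks are functions of fine ones, so the test function can be written in the fine
     blocks alone. *)
  pose G' (y : {set V} -> B) v :=
    G (fun J' => if J' \in l1 then (cs J' (y J'), y J') else z0 J') (cs J v, v).
  have := @net_step _ _ _ c0 _ w X w_ge0 w_sum lev' N lev'_le lev'N d1 N1 d1_ge0 N_N1 reg1 sym
    N (leqnn N) N_N1 _ (@std V) srs std_srs l std_topological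
    (fun k _ => @placed_std N k) l1 J l2 (fun J => (z0 J).2) G' el (fun y v => G1 _ _).
  congr (`| _ | <= _); apply: eq_mean => x; apply: eq_bigr => v _.
  rewrite nker_std; congr ((_ - _) * _).
  - by rewrite nval_std.
  - by apply: kappa_ext => J' /hp JJ; rewrite /seen JJ nval_std.
  congr (G _ _); apply: funext => J'; rewrite /y1 /seen.
  by case J'l : (J' \in l1); rewrite ?J'l // nval_std /Yp -cs_Y1.
apply: le_trans (ler_norm_mean w_ge0 _) _.
apply: le_trans (ler_mean w_ge0 (g := fun x => \sum_u `|cmass (cs J) (kB J (Y1^~ x)) u - kA J (Y0^~ x) u| +
    2 * theta * #|A|%:R) _) _.
  by move=> x; apply: refresh_err.
by rewrite meanD (mean_cst w_sum) lerD2r coarse_gap.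
Qed.

(** In [pair_net] the coarse blocks come from the network; [coarse_net] exchanges them for the true
    ones at cost [d0] per face. The comparison value is 0, because [f] vanishes at the true
    pairs. *)
Lemma coarse_refresh (f : ({set V} -> A) -> ({set V} -> B) -> R) y0 :
  (forall a y, `|f a y| <= 1) -> (forall x, f (Y0^~ x) (Y1^~ x) = 0) ->
  mean w (fun x => proc (fun J => rker J (Y0 J x)) l (f (Y0^~ x)) y0) <=
    (size l)%:R * (d1 + 2 * d0 + 2 * theta * #|A|%:R).
Proof.
move=> f1 f0; pose a0 : {set V} -> A := fun=> [ffun=> c0]; pose phi a := proc (fun J => rker J (a J)) l (f a) y0.
have phi1 a : `|phi a| <= 1.
  apply: proc_norm => // [J z v|J z].
    by apply: refresh_ge0 => // v'; apply: kappa_ge0.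
  by apply: refresh_sum => //; apply: kappa_sum.
have h1 := coarse_net a0 phi1; have h2 := pair_net a0 y0 f1.
rewrite (eq_mean w f0) (mean_cst w_sum) sub0r normrN -/phi in h2.
have -> : (size l)%:R * (d1 + 2 * d0 + 2 * theta * #|A|%:R) =
  (size l)%:R * d0 + (size l)%:R * (d1 + d0 + 2 * theta * #|A|%:R) by ring.
apply: le_trans (lerD h1 h2); apply: le_trans (ler_norm _) _.
by apply: le_trans (ler_normD _ _); rewrite subrK.
Qed.

End Coarse.

(** * Sampling a finite structure *)

Definition place (V : finType) (A B : Type) (rho : V -> A -> B) (e : {ffun V -> option A}) :
  {ffun V -> option B} := [ffun i => omap (rho i) (e i)].

Definition weight (R : realType) (V T I : finType) (mu : V -> T -> R) (f : I -> V)
    (chi : {ffun I -> T}) : R := \prod_j mu (f j) (chi j).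

Section Sample.
Variables (R : realType) (V C T : finType) (c0 : C) (mu : V -> T -> R).
Variable g : {ffun V -> option T} -> C.
Hypothesis mu_ge0 : forall i t, 0 <= mu i t.
Hypothesis mu_sum : forall i, \sum_t mu i t = 1.

Lemma weight_ge0 (I : finType) (f : I -> V) chi : 0 <= weight mu f chi.
Proof. by apply: prodr_ge0. Qed.

Lemma weight_sum (I : finType) (f : I -> V) : \sum_chi weight mu f chi = 1.
Proof.
rewrite -(bigA_distr_bigA (fun j => mu (f j))) /=.
by under eq_bigr do rewrite mu_sum; rewrite big1.
Qed.

Lemma mean_weight (I I' : finType) (f : I -> V) (f' : I' -> V) (rho : I -> I')
    (F : {ffun I -> T} -> R) :
  injective rho -> (forall j, f' (rho j) = f j) ->
  mean (weight mu f') (fun psi => F [ffun j => psi (rho j)]) = mean (weight mu f) F.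
Proof.
move=> ir fr; have := marginal ir F (fun k => mu_sum (f' k)).
rewrite /mean /weight => ->; apply: eq_bigr => chi _; congr (_ * _).
by apply: eq_bigr => j _; rewrite fr.
Qed.

Section Size.
Variable n : nat.

Definition sampleT := {ffun V * 'I_n.+1 -> T}.

Definition sampled (psi : sampleT) (e : pedge V) : C :=
  if bounded n e then g (place (fun i z => psi (i, inord z)) e) else c0.

Definition wt : sampleT -> R := weight mu fst.

(** The positions of one part are filled independently with the same law, so relabelling them
    preserves the measure. *)
Lemma sample_sym (tau : V -> nat -> nat) :
  (forall i, involutive (tau i)) -> (forall i z, (z <= n)%N -> (tau i z <= n)%N) ->
  forall Th : (pedge V -> C) -> R,
  mean wt (fun x => Th (sampled x)) = mean wt (fun x => Th (fun e => sampled x (place tau e))).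
Proof.
move=> tK tn Th.
pose rho (k : V * 'I_n.+1) : V * 'I_n.+1 := (k.1, inord (tau k.1 k.2)).
have rhoK : involutive rho.
  move=> [i z]; rewrite /rho /= inordK ?tK ?inord_val // ltnS tn //.
  by rewrite -ltnS.
rewrite -[LHS](mean_weight (f := fst) (f' := fst) (fun x => Th (sampled x)) (inv_inj rhoK)) //.
apply: eq_mean => psi; congr Th; apply: funext => e; rewrite /sampled.
have -> : bounded n (place tau e) = bounded n e.
  apply: eq_forallb => i; rewrite ffunE; case: (e i) => [z|] //=.
  by apply/idP/idP => [/(tn i)|/(tn i)] //; rewrite tK.
case: ifP => // /forallP be; congr g; apply/ffunP => i; rewrite !ffunE.
have := be i; case: (e i) => [z|] //= zn; rewrite ffunE /rho /= inordK //.
Qed.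

Lemma sample_mv (p : V -> nat) : (forall i, p i <= n)%N ->
  forall Th : (pedge V -> C) -> R,
  mean wt (fun x => Th (sampled x)) = mean wt (fun x => Th (fun e => sampled x (mv p e))).
Proof.
move=> pn; apply: (@sample_sym (fun i => swp (p i))) => [i z|i z zn].
  rewrite /swp; have [->|z0] := eqVneq z 0%N.
    by have [->|] := eqVneq (p i) 0%N; rewrite ?eqxx.
  have [->|zp] := eqVneq z (p i); first by rewrite eqxx.
  by rewrite (negPf z0) (negPf zp).
by rewrite /swp; case: (z == 0%N) => //; case: (z == p i).
Qed.

Lemma sample_place h (rho : V -> 'I_h -> nat) (F : {ffun V -> option 'I_h} -> C) :
  (forall i, injective (rho i)) -> (forall i x, (rho i x <= n)%N) ->
  mean wt (fun psi => [forall e, sampled psi (place rho e) == F e]%:R) =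
  mean (weight mu (fst : V * 'I_h -> V))
    (fun chi => [forall e, g (place (fun i x => chi (i, x)) e) == F e]%:R).
Proof.
move=> ir rn; pose r (k : V * 'I_h) : V * 'I_n.+1 := (k.1, inord (rho k.1 k.2)).
have r_inj : injective r.
  move=> [i x] [j y] [/= <-] /(congr1 val); rewrite /= !inordK ?ltnS //.
  by move=> /ir ->.
rewrite -[RHS](mean_weight (f' := fst) _ r_inj) //.
apply: eq_mean => psi; congr (nat_of_bool _)%:R; apply: eq_forallb => e.
rewrite /sampled ifT; last first.
  by apply/forallP => i; rewrite ffunE; case: (e i) => [x|] //=; apply: rn.
congr (g _ == _); apply/ffunP => i; rewrite !ffunE; case: (e i) => [x|] //=.
by rewrite ffunE.
Qed.

End Size.

Section Coarse.
Variables (lev : nat -> nat) (M n : nat).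
Hypothesis Mn : (M <= n)%N.

Definition fillin (S : {ffun V * 'I_M -> T}) (k : {ffun V -> option T}) : blkT V C M :=
  [ffun s => if within (lev #|dom k|) s then
     g [ffun i => if k i is Some t then Some t else omap (fun x => S (i, x)) (s i)]
   else c0].

Definition full_face (e : {ffun V -> T}) : {ffun V -> option T} := [ffun i => Some (e i)].

(** The vertices of [e] and of the sample [S] are independent, as are those at the positions 0 and 1
    to [M]; [r] matches the two families with the shift used in [join]. *)
Lemma coarse_law (F : ({set V} -> blkT V C M) -> R) :
  mean (weight mu (fst : V * 'I_M -> V)) (fun S =>
    mean (weight mu id) (fun e => F (fun J => fillin S (rst (full_face e) J)))) =
  mean (wt (n:=n)) (fun psi => F (fun J => yst c0 (@sampled n) lev M J psi)).
Proof.
pose f (k : V + V * 'I_M) : V := match k with inl i => i | inr p => p.1 end.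
pose r (k : V + V * 'I_M) : V * 'I_n.+1 :=
  match k with inl i => (i, ord0) | inr p => (p.1, inord p.2.+1) end.
pose glue (p : {ffun V * 'I_M -> T} * {ffun V -> T}) : {ffun V + V * 'I_M -> T} :=
  [ffun k => match k with inl i => p.2 i | inr j => p.1 j end].
pose Phi (chi : {ffun V + V * 'I_M -> T}) :=
  F (fun J => fillin [ffun p => chi (inr p)] (rst (full_face [ffun i => chi (inl i)]) J)).
have xn (x : 'I_M) : (x.+1 < n.+1)%N by rewrite ltnS (leq_trans (ltn_ord x)).
have r_inj : injective r.
  move=> [i|[i x]] [j|[j y]] //= [<-] // /(congr1 val); rewrite /= ?inordK //.
  by move=> [] /val_inj ->.
transitivity (mean (weight mu f) Phi).
  rewrite [RHS]/mean (reindex glue) /=; last first.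
    exists (fun chi => ([ffun p => chi (inr p)], [ffun i => chi (inl i)])).
      by move=> [S e] _; congr (_, _); apply/ffunP => k; rewrite !ffunE.
    by move=> chi _; apply/ffunP => -[i|p]; rewrite !ffunE.
  rewrite /mean /=; under eq_bigr do rewrite big_distrr /=.
  rewrite pair_big /=; apply: eq_bigr => -[S e] _ /=.
  rewrite mulrA; congr (_ * _).
    rewrite /weight big_sumType /= mulrC; congr (_ * _);
    by apply: eq_bigr => k _; rewrite ffunE.
  congr F; apply: funext => J; congr (fillin _ (rst (full_face _) _)).
    by apply/ffunP => p; rewrite !ffunE.
  by apply/ffunP => p; rewrite !ffunE.
rewrite -[LHS](mean_weight (f' := fst) _ r_inj); last by case.
apply: eq_mean => psi; congr F; apply: funext => J.
have dJ : dom (rst (full_face [ffun i => [ffun k => psi (r k)] (inl i)]) J) = J.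
  by rewrite dom_rst; apply/setP => i; rewrite !inE !ffunE andbT.
apply/ffunP => s; rewrite !ffunE dJ; case: ifP => // _.
rewrite /sampled ifT; last first.
  apply/forallP => i; rewrite !ffunE; case: (i \in J) => //.
  by case: (s i) => [x|] //=; rewrite -ltnS.
congr g; apply/ffunP => i; rewrite !ffunE; case: (i \in J) => /=.
  by congr (Some (psi (_, _))); apply: val_inj; rewrite /= inordK.
by case: (s i) => [x|] //=; rewrite !ffunE.
Qed.

End Coarse.
End Sample.

(** * Positive densities survive blow-ups *)

(** Otherwise the number [S] of events that occur has second moment at most
    [K + K ^ 2 * eta ^ 2 / 2], while its mean is at least [K * eta]. Cauchy-Schwarz then gives
    [K * eta ^ 2 <= 2]. *)
Lemma second_moment (R : realType) (Psi : finType) (w : Psi -> R) (K : nat)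
    (A : 'I_K -> pred Psi) (eta : R) :
  (forall x, 0 <= w x) -> \sum_x w x = 1 ->
  0 < eta -> 2 < K%:R * eta ^+ 2 ->
  (forall j, eta <= mean w (fun x => (A j x)%:R)) ->
  exists j j', j != j' /\ eta ^+ 2 / 2 <= mean w (fun x => (A j x && A j' x)%:R).
Proof.
move=> w0 w1 eta0 hK hA; apply: contrapT => h.
have h' j j' : j != j' -> mean w (fun x => (A j x && A j' x)%:R) <= eta ^+ 2 / 2.
  move=> jj; apply: ltW; rewrite ltNge; apply/negP => h1; apply: h.
  by exists j, j'.
pose S x : R := \sum_j (A j x)%:R.
have mS : K%:R * eta <= mean w S.
  rewrite /S mean_sum mulrC mulr_natr -[X in _ *+ X](card_ord K) -sumr_const.
  exact: ler_sum.
have mS2 : mean w (fun x => S x ^+ 2) <= K%:R + K%:R ^+ 2 * (eta ^+ 2 / 2).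
  have -> : mean w (fun x => S x ^+ 2) = \sum_j \sum_j' mean w (fun x => (A j x && A j' x)%:R).
    under [RHS]eq_bigr do rewrite -mean_sum.
    rewrite -mean_sum; apply: eq_mean => x; rewrite expr2 /S big_distrl /=.
    apply: eq_bigr => j _; rewrite big_distrr /=; apply: eq_bigr => j' _.
    by rewrite -mulnb natrM.
  have -> : K%:R + K%:R ^+ 2 * (eta ^+ 2 / 2) = \sum_(j < K) (1 + K%:R * (eta ^+ 2 / 2)).
    by rewrite sumr_const card_ord -[in RHS]mulr_natl; ring.
  apply: ler_sum => j _; rewrite (bigD1 j) //= lerD //.
    rewrite -[X in _ <= X](mean_cst w1); apply: ler_mean => // x.
    by case: (A j x).
  apply: (@le_trans _ _ (\sum_(j' | j' != j) eta ^+ 2 / 2)).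
    by apply: ler_sum => j'; rewrite eq_sym; apply: h'.
  rewrite sumr_const -[X in X <= _]mulr_natl ler_wpM2r //.
    by rewrite divr_ge0 // sqr_ge0.
  by rewrite ler_nat -[X in (_ <= X)%N](card_ord K) max_card.
have := le_trans (mean_sqr w0 w1 S) mS2.
have : (K%:R * eta) ^+ 2 <= mean w S ^+ 2.
  have p1 : 0 <= K%:R * eta by rewrite mulr_ge0 // ltW.
  by rewrite ler_pXn2r ?nnegrE // (le_trans p1).
have K0 : 0 < K%:R :> R.
  by rewrite ltr0n lt0n; apply/eqP => k0; move: hK; rewrite k0 mul0r; lra.
move=> h1 h2; have h3 := le_trans h1 h2.
have : K%:R * (K%:R * eta ^+ 2) <= K%:R * (1 + K%:R * eta ^+ 2 / 2).
  by apply: le_trans (le_trans _ h3) _; rewrite le_eqVlt; apply/orP; left; apply/eqP; ring.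
rewrite ler_pM2l //; lra.
Qed.

Section Blowup.
Variables (R : realType) (V C : finType) (c0 : C) (T : nat -> finType).
Variables (mu : forall n, V -> T n -> R) (g : forall n, {ffun V -> option (T n)} -> C).
Hypothesis mu_ge0 : forall n i t, 0 <= @mu n i t.
Hypothesis mu_sum : forall n i, \sum_t @mu n i t = 1.
Variables (U : set_system nat) (UU : UltraFilter U).
Hypothesis U_cofinite : forall n0 : nat, U [set n | (n0 <= n)%N]%classic.
Variables (h : nat) (F : {ffun V -> option 'I_h} -> C).

Definition occurs n (rho : V -> 'I_h -> nat) (psi : sampleT V (T n) n) : bool :=
  [forall e, sampled c0 (@g n) psi (place rho e) == F e].

Definition occ_prob n rho : R := mean (wt (@mu n) (n:=n)) (fun psi => (@occurs n rho psi)%:R).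

Definition positive rho := exists2 eta, 0 < eta & U [set n | eta <= occ_prob n rho]%classic.

Definition collisions (rho : V -> 'I_h -> nat) :=
  [set p : V * 'I_h * 'I_h | (p.1.2 != p.2) && (rho p.1.1 p.1.2 == rho p.1.1 p.2)].

Definition exch (z t a : nat) := if a == z then t else if a == t then z else a.

Lemma exchK z t : involutive (exch z t).
Proof.
move=> a; rewrite /exch; have [->|az] := eqVneq a z.
  by have [->|] := eqVneq t z; rewrite ?eqxx.
have [->|at_] := eqVneq a t; first by rewrite eqxx.
by rewrite (negPf az) (negPf at_).
Qed.

(** Moving the shared position to one of [K] fresh positions keeps the probability of the pattern,
    and two of the moves succeed together with positive probability. Then [x0] can follow one move
    and all else the other: a face has one vertex per part, so it is covered by one of the two
    events. *)
Lemma split_collision rho i0 x0 y0 : x0 != y0 -> rho i0 x0 = rho i0 y0 -> positive rho ->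
  exists2 rho', positive rho' & (#|collisions rho'| < #|collisions rho|)%N.
Proof.
move=> xy0 e0 [eta eta0 Ueta].
pose z := rho i0 x0.
pose Z := (\max_i \max_x rho i x)%N.
have rZ i x : (rho i x <= Z)%N.
  by apply: leq_trans (leq_bigmax i); apply: (leq_bigmax (F := rho i)).
pose K := (Num.bound (2 / eta ^+ 2)).+1.
have e2 : 0 < eta ^+ 2 by rewrite exprn_gt0.
have hK : 2 < K%:R * eta ^+ 2.
  rewrite -ltr_pdivrMr //; apply: lt_trans (archi_boundP _) _.
    by rewrite divr_ge0 // ltW.
  by rewrite ltr_nat.
pose t (j : 'I_K) := (Z.+1 + j)%N.
pose tau j i := if i == i0 then exch z (t j) else id.
pose rhoj j i x := tau j i (rho i x).
pose rho2 (p : 'I_K * 'I_K) i x :=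
  if (i == i0) && (x == x0) then t p.1 else rhoj p.2 i x.
have tZ j i x : rho i x == t j = false by apply/eqP; have := rZ i x; rewrite /t; lia.
have occj n j : (Z + K < n)%N -> occ_prob n (rhoj j) = occ_prob n rho.
  move=> nK; rewrite /occ_prob (@sample_sym _ _ _ _ c0 (@mu n) (@g n) (@mu_sum n) n (tau j) _ _
     (fun x => [forall e, x (place rho e) == F e]%:R)).
  - apply: eq_mean => psi; congr (nat_of_bool _)%:R; apply: eq_forallb => e.
    rewrite (_ : place (rhoj j) e = place (tau j) (place rho e)) //.
    by apply/ffunP => i; rewrite !ffunE; case: (e i).
  - by move=> i a; rewrite /tau; case: (i == i0) => //; apply: exchK.
  move=> i a an; rewrite /tau; case: (i == i0) => //; rewrite /exch.
  case: (a == z); first by rewrite /t; have := ltn_ord j; lia.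
  by case: (a == t j) => //; apply: leq_trans (rZ _ _) _; lia.
(* The good pair varies with [n], but there are finitely many pairs, so one of them is good on a set
   of the ultrafilter. *)
have [[j j'] jj Uj] : exists2 p : 'I_K * 'I_K, p.1 != p.2 &
    U [set n | eta ^+ 2 / 2 <= occ_prob n (rho2 p)]%classic.
  apply: contrapT => hno.
  have := ultra_all UU (P := fun p : 'I_K * 'I_K => [set n | p.1 != p.2 -> ~ (eta ^+ 2 / 2 <= occ_prob n (rho2 p))]%classic).
  have hN (p : 'I_K * 'I_K) : U [set n | p.1 != p.2 -> ~ (eta ^+ 2 / 2 <= occ_prob n (rho2 p))]%classic.
    have [pp|pp] := boolP (p.1 != p.2); last by apply: (ultraT UU).
    have nU : ~ U [set n | eta ^+ 2 / 2 <= occ_prob n (rho2 p)]%classic.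
      by move=> Up; apply: hno; exists p.
    by apply: (ultraS UU _ (ultraN UU nU)) => n /= h1 _.
  move=> /(_ hN) hU.
  have [n [h1 [h2 h3]]] := ultra_ex UU (ultraI UU hU (ultraI UU Ueta (U_cofinite (Z + K).+1))).
  have := @second_moment R _ (wt (@mu n) (n:=n)) K (fun j => @occurs n (rhoj j)) eta.
  move=> /(_ (fun _ => weight_ge0 (@mu_ge0 n) _ _) (weight_sum (@mu_sum n) _) eta0 hK) [].
    by move=> j; rewrite -/(occ_prob n (rhoj j)) occj.
  move=> j [j' [jj hjj]]; have := h1 (j, j') jj; apply; apply: le_trans hjj _.
  apply: ler_mean => [x|psi]; first exact: weight_ge0.
  rewrite ler_nat; case: andP => // -[/forallP o1 /forallP o2].
  rewrite lt0b; apply/forallP => e.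
  have [ex|ex] := boolP (e i0 == Some x0).
    rewrite -(eqP (o1 e)); apply/eqP; congr (sampled _ _ _ _).
    apply/ffunP => i; rewrite !ffunE /rho2 /=; have [->|] := eqVneq i i0.
      by rewrite (eqP ex) /= eqxx /rhoj /tau eqxx /exch eqxx.
    by move=> ni; case: (e i) => //= x; rewrite /rhoj /tau (negPf ni).
  rewrite -(eqP (o2 e)); apply/eqP; congr (sampled _ _ _ _).
  apply/ffunP => i; rewrite !ffunE /rho2 /=; have [->|] := eqVneq i i0.
    case ei : (e i0) => [x|] //=; case: eqP => // xx.
    by move: ex; rewrite ei xx eqxx.
  by move=> ni; case: (e i).
exists (rho2 (j, j')); first by exists (eta ^+ 2 / 2) => //; lra.
(* No new collision arises, as the targets are fresh and distinct, and that of [x0] with [y0]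
   disappears. *)
apply: proper_card; apply/fintype.properP; split.
  apply/fintype.subsetP => -[[i x] y]; rewrite !inE /= => /andP[-> /=].
  rewrite /rho2 /rhoj /tau /=; have [->|] //= := eqVneq i i0.
  have tt : t j == t j' = false by apply/eqP; rewrite /t => /addnI/val_inj/eqP; apply/negP.
  case: (x =P x0) => [->|_]; case: (y =P x0) => [->|_] //=.
  - rewrite /exch !tZ; case: ifP; first by rewrite tt.
    by move=> _; rewrite eq_sym tZ.
  - by rewrite /exch !tZ; case: ifP; rewrite ?tZ // eq_sym tt.
  by move=> /eqP/(inv_inj (exchK _ _)) ->.
exists (i0, x0, y0); rewrite inE /= xy0 /=; first by rewrite e0.
rewrite /rho2 /rhoj /tau !eqxx /= (eq_sym y0) (negPf xy0) -e0 /exch eqxx.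
by apply/eqP; rewrite /t => /addnI/val_inj/eqP; apply/negP.
Qed.

(** Collisions are removed one at a time; a placement without any is injective in each part, and
    [sample_place] applies. *)
Lemma positive_density rho : positive rho ->
  exists2 eta, 0 < eta & U [set n | eta <= mean (weight (@mu n) (fst : V * 'I_h -> V))
    (fun chi => [forall e, g (place (fun i x => chi (i, x)) e) == F e]%:R)]%classic.
Proof.
have [m] := ubnP #|collisions rho|; elim: m rho => // m IH rho hm hpos.
have [/existsP[[[i x] y]]|] := boolP [exists p, p \in collisions rho].
  rewrite inE /= => /andP[xy /eqP e].
  have [rho' hpos' hc] := split_collision xy e hpos.
  by apply: IH hpos'; apply: leq_trans hc _; rewrite -ltnS.
rewrite negb_exists => /forallP hinj; have [eta eta0 Ueta] := hpos.
exists eta => //; pose Z := (\max_i \max_x rho i x)%N.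
apply: (ultraS UU _ (ultraI UU Ueta (U_cofinite Z))) => n /= [h1 h2].
rewrite -(@sample_place _ _ _ _ c0 (@mu n) (@g n) (@mu_sum n) n h rho F) //.
- move=> i x y e; apply/eqP; have := hinj (i, x, y); rewrite inE /= e eqxx andbT.
  by rewrite negbK.
move=> i x; apply: leq_trans h2.
by apply: leq_trans (leq_bigmax i); apply: (leq_bigmax (F := rho i)).
Qed.

End Blowup.

(** * Choice of the sample sizes *)

Section Levels.
Variables (R : realType) (V C : finType) (c0 : C) (T : nat -> finType).
Variables (mu : forall n, V -> T n -> R) (g : forall n, {ffun V -> option (T n)} -> C).
Hypothesis mu_ge0 : forall n i t, 0 <= @mu n i t.
Hypothesis mu_sum : forall n i, \sum_t @mu n i t = 1.
Variables (U : set_system nat) (UU : UltraFilter U).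

Let w n := wt (@mu n) (n:=n).
Let X n := @sampled V C (T n) c0 (@g n) n.

Let w_ge0 n x : 0 <= w x := weight_ge0 (@mu_ge0 n) _ _.
Let w_sum n : \sum_x @w n x = 1 := weight_sum (@mu_sum n) _.

Definition blk_energy n m K (J : {set V}) (t : blkT V C m) : R :=
  energy (@w n) (fun x => bnd c0 K J (X x)) (fun x => (blk c0 m m (std J) (X x) == t)%:R).

Definition total_energy n m K : R := \sum_J \sum_t @blk_energy n m K J t.

Lemma total_energy_bounds n m K :
  0 <= total_energy n m K <= \sum_(J : {set V}) \sum_(t : blkT V C m) 1.
Proof.
apply/andP; split.
  by apply: sumr_ge0 => J _; apply: sumr_ge0 => t _; apply: energy_ge0.
apply: ler_sum => J _; apply: ler_sum => t _.
by apply: energy_le1 => // x; case: (_ == _); rewrite ?expr1n ?expr0n.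
Qed.

(** The level [n] nearly attains the supremum of the limiting total energies. Each single energy is
    monotone in the sample size, so the total gap bounds every individual gap. *)
Lemma select_level m d : 0 < d -> exists n : nat, (m <= n)%N /\
  forall N1 : nat, (n <= N1)%N -> U [set n' | forall J (t : blkT V C m),
    blk_energy n' N1 J t <= blk_energy n' n J t + (d / #|{: blkT V C m}|%:R) ^+ 2]%classic.
Proof.
move=> d0; set tau := (_ / _) ^+ 2.
have tau0 : 0 < tau.
  rewrite exprn_gt0 // divr_gt0 // ltr0n; apply/card_gt0P.
  by exists [ffun=> c0].
have /choice[e he] K : exists e, forall d, 0 < d -> U [set n | `|total_energy n m K - e| < d]%classic.
  exact: (ultra_lim UU (fun n => total_energy_bounds n m K)).
pose S := \sum_(J : {set V}) \sum_(t : blkT V C m) (1 : R).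
pose E := [set e K | K in [set K | (m <= K)%N]]%classic.
have eS K : e K <= S + 1.
  have [n /= hn] := ultra_ex UU (he K 1 ltr01).
  have /andP[_] := total_energy_bounds n m K; rewrite -/S.
  by move: hn; rewrite ltr_norml => /andP[]; lra.
have supE : has_sup E.
  by split; [exists (e m), m => /=|exists (S + 1) => _ [K _ <-]].
(* One quarter for each of the two limits and one for the distance to the supremum. *)
have t4 : 0 < tau / 4 by lra.
have [_ [n mn <-] hn] := sup_adherent t4 supE.
exists n; split => // N1 nN.
have hN1 : e N1 <= sup E.
  by apply: sup_upper_bound => //; exists N1 => //=; apply: leq_trans nN.
apply: (ultraS UU _ (ultraI UU (he N1 _ t4) (he n _ t4))) => n' /= [h1 h2] J t.
have gap : total_energy n' m N1 <= total_energy n' m n + tau.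
  by move: h1 h2; rewrite !ltr_norml => /andP[h11 h12] /andP[h21 h22]; lra.
have mono J' t' : @blk_energy n' m n J' t' <= blk_energy n' N1 J' t'.
  by apply: energy_mono => // x x'; apply: bnd_fac.
pose D J' t' : R := blk_energy n' N1 J' t' - @blk_energy n' m n J' t'.
have D0 J' t' : 0 <= D J' t' by rewrite subr_ge0.
have eD : total_energy n' m N1 - total_energy n' m n = \sum_J' \sum_t' D J' t'.
  by rewrite /total_energy -sumrB; apply: eq_bigr => J' _; rewrite /D [RHS]sumrB.
rewrite -lerBlDl eD in gap; rewrite -lerBlDl; apply: le_trans gap.
rewrite (bigD1 J) //= (bigD1 t) //= -addrA lerDl.
by apply: addr_ge0; apply: sumr_ge0 => *; rewrite ?sumr_ge0.
Qed.

(** Levels are selected from the largest faces down: the level of size [j] is the [(r - j)]-th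
    iterate of [nx], so the level of the boundary is [nx] of the level of the face. *)
Lemma exists_levels start d : 0 < d -> exists lev : nat -> nat,
  [/\ forall i j, (i <= j)%N -> (lev j <= lev i)%N, forall j, (start <= lev j)%N &
   forall N1, (lev 0 <= N1)%N -> U [set n' | regular c0 (@w n') (@X n') lev d N1]%classic].
Proof.
move=> d0; have /choice[nx hnx] m := select_level m d0.
pose s i := iter i nx start; pose r := #|V|.
have sS i : (s i <= s i.+1)%N by have [] := hnx (s i).
have s_le i j : (i <= j)%N -> (s i <= s j)%N.
  by move=> /subnK <-; elim: (j - i)%N => // k; rewrite addSn => /leq_trans; apply.
exists (fun j => s (r - j)%N); split.
- by move=> i j ij; apply: s_le; lia.
- by move=> j; rewrite -[start]/(s 0%N); apply: s_le.
move=> N1 hN1.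
have hJ (J : {set V}) : U [set n' | forall t : blkT V C (s (r - #|J|)%N),
    blk_energy n' N1 J t <= blk_energy n' (s (r - #|J|.-1)%N) J t +
    (d / #|{: blkT V C (s (r - #|J|)%N)}|%:R) ^+ 2]%classic.
  (* For the empty face the two sizes in [regular] coincide, but its boundary records nothing and
     there is no gap. *)
  have [->|[i iJ]] := set_0Vmem J.
    apply: (ultraT UU) => n' t; apply: (@le_trans _ _ (blk_energy n' (s (r - #|set0 : {set V}|.-1)%N) set0 t)).
      apply: energy_mono => // x x' _; apply/ffunP => e; rewrite !ffunE.
      by rewrite properE finset.sub0set andbF.
    by rewrite lerDl sqr_ge0.
  have J0 : (0 < #|J|)%N by apply/card_gt0P; exists i.
  have Jr : (#|J| <= r)%N := max_card _.
  have [_ h] := hnx (s (r - #|J|)%N).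
  have e : nx (s (r - #|J|)%N) = s (r - #|J|.-1)%N.
    by rewrite (_ : (r - #|J|.-1 = (r - #|J|).+1)%N) //; lia.
  rewrite e in h; apply: (ultraS UU _ (h N1 _)); first by move=> n' /= hh t; apply: hh.
  by apply: leq_trans hN1; apply: s_le; lia.
by apply: (ultraS UU _ (ultra_all UU hJ)) => n' /= h J t; apply: h.
Qed.

End Levels.

(** * Orderings of faces *)

Lemma sorted_split (K : eqType) (key : K -> nat) l l1 k l2 :
  sorted (relpre key leq) l -> uniq l -> l = l1 ++ k :: l2 ->
  (forall k', k' \in l -> (key k' < key k)%N -> k' \in l1) /\
  (forall k', k' \in l1 -> (key k' <= key k)%N /\ k' != k).
Proof.
have tr : transitive (relpre key leq) by move=> a b c; apply: leq_trans.
rewrite sorted_pairwise // => ps ul el; move: ps ul.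
rewrite el pairwise_cat /= cat_uniq /= => /and3P[/allrelP ps _ /andP[/allP p2 _]] /and3P[_ ud _].
split=> [k'|k' kl].
  rewrite mem_cat inE => /or3P[//|/eqP ->|/p2 /= h]; first by rewrite ltnn.
  by rewrite ltnNge h.
split; first by apply: (ps k' k) => //; rewrite inE eqxx.
by apply: contra ud => /eqP <-; rewrite kl.
Qed.

Section Orders.
Variable V : finType.

Definition set_order : seq {set V} :=
  sort (relpre (fun J : {set V} => #|J|) leq) (enum {set V}).

Let le_total : total (relpre (fun J : {set V} => #|J|) leq).
Proof. by move=> I J; apply: leq_total. Qed.

Lemma set_order_sorted : sorted (relpre (fun J : {set V} => #|J|) leq) set_order.
Proof. exact: sort_sorted. Qed.

Lemma mem_set_order J : J \in set_order.
Proof. by rewrite mem_sort mem_enum. Qed.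

Lemma set_order_uniq : uniq set_order.
Proof. by rewrite sort_uniq enum_uniq. Qed.

Lemma set_order_topo l1 J l2 : set_order = l1 ++ J :: l2 ->
  (forall J' : {set V}, J' \proper J -> J' \in l1) /\
  (forall J' : {set V}, J' \in l1 -> ~~ (J \subset J')).
Proof.
move=> /(sorted_split set_order_sorted set_order_uniq) [h1 h2].
split=> J' h; first by apply: h1; rewrite ?mem_set_order // proper_card.
have [c n] := h2 _ h; apply: contra n => s.
by rewrite eq_sym eqEcard s c.
Qed.

Lemma index_card I J : (index I set_order <= index J set_order)%N -> (#|I| <= #|J|)%N.
Proof.
apply: (sorted_leq_index (leT := relpre (fun J : {set V} => #|J|) leq));
  rewrite ?mem_set_order ?set_order_sorted //.
- by move=> a b c; apply: leq_trans.
- by move=> a; apply: leqnn.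
Qed.

Variable T : finType.
Notation K := {ffun V -> option T}.

(** Using the index of the domain instead of its cardinality lists the faces of each full choice in
    exactly the order [set_order], as [face_order_restrict] requires. *)
Definition face_key (k : K) := index (dom k) set_order.

Definition face_order : seq K := sort (relpre face_key leq) (enum {: K}).

Lemma face_order_sorted : sorted (relpre face_key leq) face_order.
Proof. by apply: sort_sorted => k k'; apply: leq_total. Qed.

Lemma mem_face_order k : k \in face_order.
Proof. by rewrite mem_sort mem_enum. Qed.

Lemma face_order_uniq : uniq face_order.
Proof. by rewrite sort_uniq enum_uniq. Qed.

Variable N : nat.

(** All points of a finite structure get distinct positions beyond the sample, so one sampled
    structure displays a coloring of all its faces. *)
Definition pos (k : K) : pedge V := place (fun _ (t : T) => (N.+1 + enum_rank t)%N) k.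

Lemma dom_pos k : dom (pos k) = dom k.
Proof. by apply/setP => i; rewrite !inE ffunE; case: (k i). Qed.

Lemma pos_rst k J : pos (rst k J) = rst (pos k) J.
Proof. by apply/ffunP => i; rewrite !ffunE; case: (i \in J). Qed.

Lemma pos_inj : injective pos.
Proof.
move=> k k' /ffunP h; apply/ffunP => i; have := h i; rewrite !ffunE.
case: (k i) => [t|]; case: (k' i) => [t'|] //= [] /addnI/val_inj/enum_rank_inj -> //.
Qed.

Lemma pos_placed k : placed N (N + #|T|) (pos k).
Proof.
move=> i z; rewrite ffunE; case: (k i) => [t|] //= [<-].
by rewrite !addSn ltnS leq_addr orbT /= -addnS leq_add2l ltn_ord.
Qed.

Lemma face_order_topo : topological pos (@rst V T) face_order.
Proof.
move=> l1 k l2 el; have [h1 h2] := sorted_split face_order_sorted face_order_uniq el.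
rewrite dom_pos; split=> [J JJ|k' /h2[c n]].
  apply: h1; first exact: mem_face_order.
  rewrite /face_key dom_rst (setIidPl (proper_sub JJ)) ltnNge.
  by apply: contraL (proper_card JJ) => /index_card; rewrite -leqNgt.
apply: contra n => s; apply/eqP; apply: pos_inj; apply/esym/(sub_card_eq s).
by rewrite !dom_pos; apply: index_card.
Qed.

Lemma face_order_restrict (e : {ffun V -> T}) :
  [seq dom k | k <- face_order & rst (full_face e) (dom k) == k] = set_order.
Proof.
have dJ J : dom (rst (full_face e) J) = J.
  by rewrite dom_rst; apply/setP => i; rewrite !inE !ffunE andbT.
pose le := relpre (fun J => index J set_order) leq.
apply: (@sorted_eq _ le).
- by move=> a b c; apply: leq_trans.
- move=> I J h; have hi : index I set_order = index J set_order by apply/eqP; rewrite eqn_leq.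
  by rewrite -(nth_index I (mem_set_order I)) hi nth_index ?mem_set_order.
- rewrite sorted_map; apply: (sorted_filter (leT := relpre face_key leq)); last exact: face_order_sorted.
  by move=> a b c; apply: leq_trans.
- apply/(sortedP set0) => i hi; rewrite /le /= !index_uniq ?set_order_uniq //.
  exact: ltnW.
apply: uniq_perm; [|exact: set_order_uniq|].
  rewrite map_inj_in_uniq ?filter_uniq ?face_order_uniq // => k k'.
  by rewrite !mem_filter => /andP[/eqP hk _] /andP[/eqP hk' _] e'; rewrite -hk -hk' e'.
move=> J; rewrite mem_set_order; apply/mapP; exists (rst (full_face e) J); rewrite ?dJ //.
by rewrite mem_filter dJ eqxx mem_face_order.
Qed.

End Orders.

(** * Redrawing the fine blocks of all faces *)

Section Repair.
Variables (R : realType) (V C : finType) (c0 : C).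
Variables (Psi : finType) (w : Psi -> R) (X : Psi -> pedge V -> C).
Hypothesis w_ge0 : forall x, 0 <= w x.
Hypothesis w_sum : \sum_x w x = 1.
Variables (lev lev' : nat -> nat) (M N N1 : nat) (d1 theta : R) (T : finType).
Hypothesis lev'_le : forall i j, (i <= j)%N -> (lev' j <= lev' i)%N.
Hypothesis lev'N : forall j, (lev' j <= N)%N.
Hypothesis N_N1 : (N + #|T| < N1)%N.
Hypothesis d1_ge0 : 0 <= d1.
Hypothesis reg1 : regular c0 w X lev' d1 N1.
Hypothesis sym : forall p : V -> nat, (forall i, p i <= N1)%N ->
  forall Th : (pedge V -> C) -> R,
  mean w (fun x => Th (X x)) = mean w (fun x => Th (fun e => X x (mv p e))).
Hypothesis theta_gt0 : 0 < theta.

Notation K := {ffun V -> option T}.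

Definition face_ker (a : K -> blkT V C M) (k : K) (y : K -> blkT V C N) (v : blkT V C N) : R :=
  rker c0 w X lev lev' theta (dom k) (a k) (fun J => y (rst k J)) v.

Lemma face_ker_ge0 a k y v : 0 <= face_ker a k y v.
Proof. by apply: refresh_ge0 => v'; apply: kappa_ge0. Qed.

Lemma face_ker_sum a k y : \sum_v face_ker a k y v = 1.
Proof. by apply: refresh_sum => //; apply: kappa_sum. Qed.

(** Each redraw has density at most [theta^-1] against the network kernel, and the network is
    compared with the true blocks at [pos]. The factor involves neither [N] nor [d1], so [d1] can be
    chosen small against it. *)
Lemma face_proc_le a (h : (K -> blkT V C N) -> R) y0 :
  theta <= 1 -> (forall y, 0 <= h y <= 1) ->
  proc (face_ker a) (face_order V T) h y0 <=
  theta^-1 ^+ size (face_order V T) *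
   (mean w (fun x => h (fun k => nval c0 X lev' N (pos N) k x)) + (size (face_order V T))%:R * d1).
Proof.
move=> t1 h01; set l := face_order V T.
have h0 y : 0 <= h y by have /andP[] := h01 y.
pose ker := nker c0 w X lev' (N := N) (pos (T := T) N) (@rst V T).
have step : proc (face_ker a) l h y0 <= theta^-1 ^+ size l * proc ker l h y0.
  apply: proc_dom => //; last by rewrite invr_ge0 ltW.
  move=> k y v; rewrite face_ker_ge0 /= /ker /nker dom_pos.
  by apply: refresh_le => // v'; apply: kappa_ge0.
apply: (le_trans step); rewrite ler_wpM2l ?exprn_ge0 ?invr_ge0 ?(ltW theta_gt0) //.
have := @net_hybrid _ _ _ c0 _ w X w_ge0 w_sum lev' N lev'_le lev'N d1 N1 d1_ge0
  (leq_ltn_trans (leq_addr _ _) N_N1) reg1 sym (N + #|T|)%N (leq_addr _ _) N_N1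
  _ (pos (T := T) N) (@rst V T) (@pos_rst V T N) l (@face_order_topo V T N)
  (fun k _ => @pos_placed V T N k) h y0.
have h1 y : `|h y| <= 1 by have /andP[? ?] := h01 y; rewrite ger0_norm.
move=> /(_ h1); rewrite (@eq_mean _ _ _ _ (fun x => h (fun k => nval c0 X lev' N (pos N) k x))).
  by rewrite -/ker distrC => /(le_trans (ler_norm _)); rewrite lerBlDl.
by move=> x; congr h; apply: funext => k; rewrite /seen mem_face_order.
Qed.

(** The kernel at a face of [e] consults only its subfaces, again faces of [e]; seen from [e] alone,
    the redrawing is the process of [coarse_refresh]. *)
Lemma face_proc_pull a (e : {ffun V -> T}) (f : ({set V} -> blkT V C N) -> R) y0 :
  proc (face_ker a) (face_order V T) (fun y => f (fun J => y (rst (full_face e) J))) y0 =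
  proc (fun J => rker c0 w X lev lev' theta J (a (rst (full_face e) J))) (set_order V) f
    (fun J => y0 (rst (full_face e) J)).
Proof.
have dJ J : dom (rst (full_face e) J) = J.
  by rewrite dom_rst; apply/setP => i; rewrite !inE !ffunE andbT.
rewrite -[set_order V](face_order_restrict e).
apply: (@proc_pull _ _ _ _ (face_ker a) _ (rst (full_face e))
  (fun k => rst (full_face e) (dom k) == k) (@dom V T)).
- by move=> k /eqP.
- by move=> J; rewrite dJ eqxx.
- move=> k y v /eqP ek; rewrite /face_ker ek /rker.
  congr (refresh _ _ _ _ _); apply: funext => v'; apply: kappa_ext => J JJ /=.
  by rewrite -{1}ek rst_rst (setIidPl (proper_sub JJ)).
by move=> k y; apply: face_ker_sum.
Qed.

End Repair.

(** * The ultrafilter removal lemma *)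

(* The coordinate of a block that reads the color of the face itself. *)
Definition vacant (V : finType) N : {ffun V -> option 'I_N} := [ffun=> None].

Lemma blk_vacant (V C : finType) (c0 : C) N n (e : pedge V) x :
  blk c0 N n e x (vacant V N) = x e.
Proof.
rewrite ffunE ifT; last by apply/forallP => i; rewrite ffunE.
by congr x; apply/ffunP => i; rewrite !ffunE; case: (e i).
Qed.

Section Arithmetic.
Variables (R : realFieldType) (x y e : R).

Lemma error_ge0 : 0 <= e -> 0 < x -> 0 < y -> 0 <= x + 2 * y + e.
Proof. lra. Qed.

Lemma error_le : y <= x -> e <= 2 * x -> y + 2 * x + e <= 5 * x.
Proof. lra. Qed.

Lemma error_quarter : 0 < e -> e * (5 / 32) <= e / 4.
Proof. lra. Qed.

Lemma add_quarter : x <= e / 4 -> x + e / 4 <= e / 2.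
Proof. lra. Qed.

Lemma half_lt : 0 < e -> e / 2 < 5 / 8 * e.
Proof. lra. Qed.

Lemma two_eighths : e / 8 + e / 8 <= 1 / 4 * e.
Proof. lra. Qed.

Lemma add_lt1 : x < 5 / 8 -> y <= 1 / 4 -> x + y < 1.
Proof. lra. Qed.

Lemma add_lt1l : x + y < 1 -> 0 <= y -> x < 1.
Proof. lra. Qed.

End Arithmetic.

Section Core.
Variables (R : realType) (V C : finType) (c0 : C) (T : nat -> finType).
Variables (mu : forall n, V -> T n -> R) (g : forall n, {ffun V -> option (T n)} -> C).
Hypothesis mu_ge0 : forall n i t, 0 <= @mu n i t.
Hypothesis mu_sum : forall n i, \sum_t @mu n i t = 1.
Variables (U : set_system nat) (UU : UltraFilter U).
Hypothesis U_cofinite : forall n0 : nat, U [set n | (n0 <= n)%N]%classic.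

Let w n := wt (@mu n) (n:=n).
Let X n := @sampled V C (T n) c0 (@g n) n.

Let w_ge0 n x : 0 <= @w n x := weight_ge0 (@mu_ge0 n) _ _.
Let w_sum n : \sum_x @w n x = 1 := weight_sum (@mu_sum n) _.

Definition density n h (F : {ffun V -> option 'I_h} -> C) : R :=
  mean (weight (@mu n) (fst : V * 'I_h -> V))
    (fun chi => [forall e, g (place (fun i x => chi (i, x)) e) == F e]%:R).

(** [phi] may repeat vertices, so degenerate patterns of [q] must have positive limit density
    too. *)
Definition persistent n (q : {ffun V -> option (T n)} -> C) :=
  forall h (phi : V -> 'I_h -> T n),
  exists2 eta, 0 < eta & U [set n' | eta <= density n' (fun e => q (place phi e))]%classic.

(** The tuple of blocks takes finitely many values, each with a limiting probability along [U]; on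
    [D] all probabilities are close to their limits. *)
Lemma law_close (lev : nat -> nat) M tau : 0 < tau -> exists D : set nat, U D /\
  forall n n', D n -> D n' -> forall F : ({set V} -> blkT V C M) -> R,
  (forall a, `|F a| <= 1) ->
  mean (@w n) (fun x => F (fun J => yst c0 (@X n) lev M J x)) <=
  mean (@w n') (fun x => F (fun J => yst c0 (@X n') lev M J x)) + tau.
Proof.
move=> tau0.
pose p n (a : {ffun {set V} -> blkT V C M}) : R :=
  mean (@w n) (fun x => ([ffun J => yst c0 (@X n) lev M J x] == a)%:R).
have pb a n : 0 <= p n a <= 1.
  apply/andP; split; first by apply: mean_ge0.
  by rewrite -[X in _ <= X](mean_cst (@w_sum n)); apply: ler_mean => // x; case: (_ == _).
have /choice[l hl] a : exists l, forall d, 0 < d -> U [set n | `|p n a - l| < d]%classic.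
  exact: (ultra_lim UU (pb a)).
pose c : R := #|{: {ffun {set V} -> blkT V C M}}|%:R.
have c0_ : 0 < c by rewrite ltr0n; apply/card_gt0P; exists [ffun=> [ffun=> c0]].
have t2 : 0 < tau / (2 * c) by rewrite divr_gt0 // mulr_gt0.
have hD := ultra_all UU (fun a => hl a _ t2).
eexists; split; first exact: hD.
move=> n n' /= hn hn' F F1.
have mF m : mean (@w m) (fun x => F (fun J => yst c0 (@X m) lev M J x)) =
    \sum_(a : {ffun {set V} -> blkT V C M}) F a * p m a.
  under [RHS]eq_bigr do rewrite -meanZ.
  rewrite -mean_sum; apply: eq_mean => x.
  rewrite (bigD1 [ffun J => yst c0 (@X m) lev M J x]) //= eqxx mulr1 big1 ?addr0.
    by congr F; apply: funext => J; rewrite ffunE.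
  by move=> a /negPf na; rewrite eq_sym na mulr0.
rewrite !mF -lerBlDl -sumrB.
apply: (@le_trans _ _ (\sum_(a : {ffun {set V} -> blkT V C M}) tau / c)).
  apply: ler_sum => a _; rewrite -mulrBr; apply: le_trans (ler_norm _) _.
  rewrite normrM; apply: (@le_trans _ _ `|p n a - p n' a|); first by rewrite ler_piMl.
  apply: le_trans (ler_distD (l a) _ _) _.
  have -> : tau / c = tau / (2 * c) + tau / (2 * c).
    by field; rewrite gt_eqF.
  by apply: lerD; [|rewrite distrC]; apply: ltW.
by rewrite sumr_const -[X in X <= _]mulr_natr -/c divfK ?gt_eqF.
Qed.

(** There are finitely many [q]. If one appeared at [pos] with probability at least [eta] on a set
    of the ultrafilter, [positive_density] would give all its patterns positive density, collisions
    of [phi] included. *)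
Lemma rare_patterns n N eta : 0 < eta ->
  U [set n' | forall q : {ffun {ffun V -> option (T n)} -> C}, ~ persistent q ->
    mean (@w n') (fun x => [forall k, X x (pos N k) == q k]%:R) < eta]%classic.
Proof.
move=> eta0; apply: (ultra_all UU (P := fun q : {ffun {ffun V -> option (T n)} -> C} =>
  [set n' | ~ persistent q ->
    mean (@w n') (fun x => [forall k, X x (pos N k) == q k]%:R) < eta]%classic)) => q.
have [pq|npq] := pselect (persistent q); first by apply: (ultraT UU) => n' np; case: (np pq).
set P := [set n' | mean (@w n') (fun x => [forall k, X x (pos N k) == q k]%:R) < eta]%classic.
suff : U P by apply: (ultraS UU) => n' /= h _.
apply: contrapT => /(ultraN UU) hU; apply: npq => h phi.
apply: (@positive_density _ _ _ c0 _ _ _ mu_ge0 mu_sum _ UU U_cofinite _ _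
  (fun i x => (N.+1 + enum_rank (phi i x))%N)).
exists eta => //; apply: (ultraS UU _ hU) => n' /= /negP; rewrite -leNgt => hn'.
apply: le_trans hn' _; apply: ler_mean => // x.
rewrite ler_nat; case: forallP => // hx; rewrite lt0b; apply/forallP => e.
rewrite -(eqP (hx (place phi e))) /X; apply/eqP; congr (sampled _ _ _ _).
by apply/ffunP => i; rewrite !ffunE; case: (e i).
Qed.

(** The choices are made in the order [d0], [lev], [theta], [n], [d1], [lev'], [n']. Thus [d1] can
    beat the density bound, which depends on [theta] and the number of faces of the [n]-th
    structure. *)
Theorem ultra_removal eps : 0 < eps -> exists n (q : {ffun V -> option (T n)} -> C),
  persistent q /\
  forall I : {set V}, mean (weight (@mu n) id)
    (fun e => (q (rst (full_face e) I) != g (rst (full_face e) I))%:R) <= eps.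
Proof.
move=> eps0.
pose Ls := set_order V.
have [s s0 sL] : exists2 s : R, 0 < s & (size Ls)%:R <= s.
  by exists (size Ls).+1%:R; rewrite ?ltr0n ?ler_nat.
pose d0 := eps / (32 * s).
have d00 : 0 < d0 by rewrite divr_gt0 // mulr_gt0.
have [lev [lev_le _ reg0]] := exists_levels c0 g mu_ge0 mu_sum UU 0 d00.
pose M := lev 0%N.
have levM j : (lev j <= M)%N by apply: lev_le.
have [cA cA0 cAE] : exists2 c : R, 0 < c & #|{: blkT V C M}|%:R = c.
  by exists #|{: blkT V C M}|%:R => //; rewrite ltr0n; apply/card_gt0P; exists [ffun=> c0].
(* The bound 1 is for the density estimate; the other makes the loss from unlikely coarse blocks
   small against [eps]. *)
pose theta := Num.min 1 (eps / (32 * s * cA)).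
have theta0 : 0 < theta by rewrite lt_min ltr01 divr_gt0 // !mulr_gt0.
have theta1 : theta <= 1 by rewrite ge_min lexx.
have thetaA : 2 * theta * cA <= 2 * (eps / (32 * s)).
  have : theta <= eps / (32 * s * cA) by rewrite ge_min lexx orbT.
  rewrite -(ler_pM2r cA0) => h.
  have e : eps / (32 * s * cA) * cA = eps / (32 * s) by field; rewrite !gt_eqF.
  by rewrite e in h; rewrite -mulrA ler_pM2l.
have e4 : 0 < eps / 4 by rewrite divr_gt0.
have [D [UD hD]] := law_close lev M e4.
have [n [Dn Mn]] := ultra_ex UU (ultraI UU UD (U_cofinite M)).
pose K : finType := {ffun V -> option (T n)}.
pose l := face_order V (T n).
have [L L0 lL] : exists2 L : R, 0 < L & (size l)%:R <= L.
  by exists (size l).+1%:R; rewrite ?ltr0n ?ler_nat.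
pose th := theta ^+ size l.
have th0 : 0 < th by rewrite exprn_gt0.
(* The first bound serves the coarse estimate, the second absorbs the density factor [th^-1] and the
   number of faces. *)
pose d1 := Num.min (eps / (32 * s)) (th / (8 * L)).
have d10 : 0 < d1 by rewrite lt_min !divr_gt0 // mulr_gt0.
have [lev' [lev'_le Mlev' reg1]] := exists_levels c0 g mu_ge0 mu_sum UU M d10.
pose N := lev' 0%N.
have lev'N j : (lev' j <= N)%N by apply: lev'_le.
pose N1 := (N + #|T n|).+1.
have NN1 : (N < N1)%N by rewrite ltnS leq_addr.
have MN1 : (M <= N1)%N by apply: leq_trans (ltnW NN1); apply: Mlev'.
have [cq cq0 cqE] : exists2 c : R, 0 < c & #|{: {ffun {ffun V -> option (T n)} -> C}}|%:R = c.
  by exists #|{: {ffun {ffun V -> option (T n)} -> C}}|%:R => //; rewrite ltr0n; apply/card_gt0P; exists [ffun=> c0].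
have eta0 : 0 < th / (8 * cq) by rewrite divr_gt0 // mulr_gt0.
(* The index [n'] supplies the conditional laws: its coarse law is close to that of [n], it is
   regular at both scales, and patterns on the [n]-th structure that do not persist are rare in
   it. *)
have [n' [Dn' [r0 [r1 [N1n' rare]]]]] := ultra_ex UU (ultraI UU UD (ultraI UU (reg0 N1 MN1)
  (ultraI UU (reg1 N1 (ltnW NN1)) (ultraI UU (U_cofinite N1) (@rare_patterns n N _ eta0))))).
have sym (p : V -> nat) : (forall i, p i <= N1)%N -> forall Th : (pedge V -> C) -> R,
    mean (@w n') (fun x => Th (X x)) = mean (@w n') (fun x => Th (fun e => X x (mv p e))).
  by move=> pN; apply: sample_mv => // i; apply: leq_trans N1n'.
pose y0 : K -> blkT V C N := fun=> [ffun=> c0].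
pose vN := vacant V N; pose vM := vacant V M.
(* [f] detects that redrawing has changed the color of some face. *)
pose f (a : {set V} -> blkT V C M) (y : {set V} -> blkT V C N) : R :=
  [exists I, y I vN != a I vM]%:R.
have f01 a y : 0 <= f a y <= 1 by rewrite /f ler0n lern1 leq_b1.
have f1 a y : `|f a y| <= 1 by have /andP[h1 h2] := f01 a y; rewrite ger0_norm.
pose Phi (a : {set V} -> blkT V C M) : R :=
  proc (fun J => rker c0 (@w n') (@X n') lev lev' theta J (a J)) Ls (f a) (fun=> [ffun=> c0]).
have Phi1 a : `|Phi a| <= 1.
  apply: proc_norm => // [J z v|J z].
    by apply: refresh_ge0 => // v'; apply: kappa_ge0.
  by apply: refresh_sum => //; apply: kappa_sum.
have hcoarse : mean (@w n') (fun x => Phi (fun J => yst c0 (@X n') lev M J x)) <= eps / 4.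
  have := @coarse_refresh _ _ _ c0 _ (@w n') (@X n') (@w_ge0 n') (@w_sum n') lev lev' M N N1 d0 d1 theta
    lev_le levM lev'_le lev'N Mlev' NN1 (ltW d00) (ltW d10) r0 r1 sym theta0 Ls
    (@set_order_topo V) (set_order_uniq V) (@mem_set_order V) f (fun=> [ffun=> c0]) f1.
  move=> h; apply: le_trans (h _) _.
    by move=> x; rewrite /f (_ : [exists _, _] = false) //; apply/existsP => -[I]; rewrite !blk_vacant eqxx.
  have d1le : d1 <= eps / (32 * s) by rewrite ge_min lexx.
  apply: (@le_trans _ _ (s * (5 * (eps / (32 * s))))).
    have tA : 0 <= 2 * theta * cA by rewrite !mulr_ge0 ?ltW.
    rewrite cAE; apply: ler_pM => //; first exact: error_ge0.
    exact: error_le d1le thetaA.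
  rewrite (_ : s * _ = eps * (5 / 32)); first exact: error_quarter.
  by field; rewrite gt_eqF.
(* [Phi] depends on the coarse blocks only, so the estimate passes from [n'] to [n]. *)
have hn : mean (@w n) (fun x => Phi (fun J => yst c0 (@X n) lev M J x)) <= eps / 2.
  by apply: le_trans (hD n n' Dn Dn' Phi Phi1) _; exact: add_quarter.
(* One coarse sample of the [n]-th structure is fixed, with at most average damage. *)
have [S hS] : exists S, mean (weight (@mu n) id) (fun e => Phi (fun J =>
    fillin c0 (@g n) lev S (rst (full_face e) J) : blkT V C M)) < 5 / 8 * eps.
  apply: (mean_lt_ex (w := weight (@mu n) (fst : V * 'I_M -> V))).
  - by move=> S; apply: weight_ge0.
  - exact: weight_sum.
  by rewrite (coarse_law c0 (@g n) (@mu_sum n) lev Mn); apply: le_lt_trans hn _; exact: half_lt.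
pose a (k : K) : blkT V C M := fillin c0 (@g n) lev S k.
pose ker := face_ker c0 (@w n') (@X n') lev lev' (N := N) theta a.
have ker0 k y v : 0 <= ker k y v by apply: face_ker_ge0.
have ker1 k y : \sum_v ker k y v = 1 by apply: face_ker_sum.
pose bad (y : K -> blkT V C N) : R := `[< ~ persistent (fun k => y k vN) >]%:R.
pose dis (y : K -> blkT V C N) : R := mean (weight (@mu n) id)
  (fun e => f (fun J => a (rst (full_face e) J)) (fun J => y (rst (full_face e) J))).
(* Among the true blocks at [pos], the bad event is a union of rare patterns; the density bound
   carries this over to the redrawn blocks. *)
have hbad : proc ker l bad y0 <= 1 / 4.
  have := @face_proc_le _ _ _ c0 _ (@w n') (@X n') (@w_ge0 n') (@w_sum n') lev lev' M N N1 d1 theta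
    (T n) lev'_le lev'N (ltnSn _) (ltW d10) r1 sym theta0 a bad y0 theta1 _.
  move=> h; apply: le_trans (h _) _; first by move=> y; rewrite /bad ler0n lern1 leq_b1.
  rewrite -/l exprVn -/th mulrC ler_pdivrMr //.
  have b1 : mean (@w n') (fun x => bad (fun k => nval c0 (@X n') lev' N (pos N) k x)) <= th / 8.
    apply: (@le_trans _ _ (\sum_(q : {ffun {ffun V -> option (T n)} -> C} | `[< ~ persistent q >])
        mean (@w n') (fun x => [forall k, X x (pos N k) == q k]%:R))).
      rewrite -mean_sum; apply: ler_mean => // x; rewrite /bad.
      case: asboolP => [np|_]; last by apply: sumr_ge0.
      rewrite (bigD1 [ffun k => X x (pos N k)]) /=; last first.
        apply/asboolP => hp; apply: np => h' phi; have := hp h' phi.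
        have eF : (fun e : {ffun V -> option 'I_h'} => nval c0 (@X n') lev' N (pos N) (place phi e) x vN) =
            (fun e => [ffun k => X x (pos N k)] (place phi e)).
          by apply: funext => e; rewrite ffunE /nval blk_vacant.
        by rewrite eF.
      have fa : [forall k : {ffun V -> option (T n)}, X x (pos N k) == [ffun k => X x (pos N k)] k].
        by apply/forallP => k; rewrite ffunE.
      by rewrite fa lerDl sumr_ge0.
    apply: (@le_trans _ _ (\sum_(q : {ffun {ffun V -> option (T n)} -> C}) th / (8 * cq))).
      rewrite big_mkcond /=; apply: ler_sum => q _; case: asboolP => [np|_]; last exact: ltW.
      by apply: ltW; apply: rare.
    rewrite sumr_const -[X in X <= _]mulr_natr cqE le_eqVlt; apply/orP; left; apply/eqP.
    by field; rewrite gt_eqF.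
  have b2 : (size l)%:R * d1 <= th / 8.
    apply: (@le_trans _ _ (L * (th / (8 * L)))).
      apply: ler_pM; [by []|exact: ltW|by []|by rewrite ge_min lexx orbT].
    by rewrite le_eqVlt; apply/orP; left; apply/eqP; field; rewrite gt_eqF.
  by apply: le_trans (lerD b1 b2) _; exact: two_eighths.
have hdis : proc ker l dis y0 < 5 / 8 * eps.
  apply: le_lt_trans hS; rewrite /dis /mean proc_sum le_eqVlt; apply/orP; left; apply/eqP.
  apply: eq_bigr => e _; congr (_ * _).
  by rewrite (face_proc_pull c0 (@w n') (@X n') lev lev' theta0 a e (f (fun J => a (rst (full_face e) J)))).
(* The expectation is below [5 / 8 + 1 / 4]. As [bad] takes the values 0 and 1, the outcome [y] is
   persistent and [dis y < eps]. *)
have [y hy] : exists y, eps^-1 * dis y + bad y < 1.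
  apply: (proc_lt_ex (ker := ker) ker0 ker1 (l := l) (y := y0)).
  pose c2 (b : bool) : R := if b then eps^-1 else 1.
  pose F2 (b : bool) := if b then dis else bad.
  have -> : (fun y => eps^-1 * dis y + bad y) = (fun y => \sum_b c2 b * F2 b y).
    by apply: funext => y; rewrite big_bool /= mul1r.
  rewrite proc_sum big_bool /= mul1r.
  have : eps^-1 * proc ker l dis y0 < 5 / 8 by rewrite mulrC ltr_pdivrMr.
  by move=> h; exact: add_lt1 h hbad.
have dis0 z : 0 <= dis z.
  by apply: mean_ge0 => [e|e]; [apply: weight_ge0|rewrite /f ler0n].
have ei : 0 < eps^-1 by rewrite invr_gt0.
exists n, (fun k => y k vN); split.
  apply: contrapT => np; move: hy; rewrite /bad asboolT //.
  by rewrite gtrDr ltNge mulr_ge0 // ltW.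
move=> I.
have bad0 : 0 <= bad y by [].
have : eps^-1 * dis y < 1 by exact: add_lt1l hy bad0.
rewrite mulrC ltr_pdivrMr // mul1r => h; apply: ltW; apply: le_lt_trans h.
apply: ler_mean => [e|e]; first exact: weight_ge0.
rewrite ler_nat; case: eqP => // ne; rewrite lt0b; apply/existsP; exists I.
apply/eqP => h; apply: ne; rewrite h ffunE ifT.
  by congr g; apply/ffunP => i; rewrite !ffunE; case: (i \in I).
by apply/forallP => i; rewrite ffunE.
Qed.

End Core.

(** * Translation to partite hypergraphs *)

Section Points.
Variables (R : realType) (V : finType) (Om : V -> fin_prob_space R).

(** The disjoint union provides one point type for all parts; [pmass i] is supported on part [i]. *)
Definition point : finType := {i : V & outcome (Om i)}.

Definition tagp i (x : Om i) : point := Tagged (fun i => outcome (Om i)) x.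

Definition pmass (i : V) (t : point) : R := \sum_(x : Om i | tagp x == t) mass x.

Lemma pmass_ge0 i t : 0 <= pmass i t.
Proof. by apply: sumr_ge0 => x _; apply: mass_ge0. Qed.

Lemma pmass_sum i : \sum_t pmass i t = 1.
Proof.
rewrite /pmass (exchange_big_dep predT) //= -[RHS](mass_sum (Om i)).
by apply: eq_bigr => x _; rewrite (big_pred1 (tagp x)) // => t; rewrite eq_sym.
Qed.

Lemma pmass_tagp i (x : Om i) : pmass i (tagp x) = mass x.
Proof. by rewrite /pmass (big_pred1 x) // => y; rewrite /tagp eq_Tagged. Qed.

Lemma pmass_neq0 i t : pmass i t != 0 -> tag t = i.
Proof.
apply: contraNeq => ti; rewrite /pmass big_pred0 // => x.
by apply/eqP => e; rewrite -e eqxx in ti.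
Qed.

Lemma outcome_exists i : exists x : Om i, true.
Proof.
apply: contrapT => h; have := oner_neq0 R; rewrite -(mass_sum (Om i)) big1 ?eqxx // => x _.
by case: h; exists x.
Qed.

Definition base i : Om i := xchoose (outcome_exists i).

Definition untagp i (t : point) : Om i := untag (base i) id t.

Lemma untagpK i t : tag t = i -> tagp (untagp i t) = t.
Proof. by move=> e; rewrite /untagp (untagE _ _ e) /tagp etaggedK. Qed.

Lemma tagpK i (x : Om i) : untagp i (tagp x) = x.
Proof.
have := untagpK (i := i) (t := tagp x) erefl; rewrite /tagp; exact: eq_from_Tagged.
Qed.

(** Choices with a coordinate in a wrong part have weight 0, and the others correspond to the
    choices in the product. *)
Lemma prob_weight (J : finType) (idx : J -> V)
    (E : pred {dffun forall j : J, Om (idx j)}) :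
  prob (S := fun j => Om (idx j)) E =
  mean (weight pmass idx) (fun chi : {ffun J -> point} =>
    (E [ffun j => untagp (idx j) (chi j)])%:R).
Proof.
rewrite /mean (bigID (fun chi : {ffun J -> point} => [forall j, tag (chi j) == idx j])) /=.
rewrite [X in _ = _ + X]big1 ?addr0; last first.
  move=> chi; rewrite negb_forall => /existsP[j hj].
  have -> : weight pmass idx chi = 0; last by rewrite mul0r.
  apply/eqP/prodf_eq0; exists j => //; apply: contraNT hj => /pmass_neq0 ->.
  exact: eqxx.
rewrite (reindex_onto (fun x : {dffun forall j : J, Om (idx j)} => [ffun j => tagp (x j)])
   (fun chi => [ffun j => untagp (idx j) (chi j)])) /=; last first.
  move=> chi /forallP h; apply/ffunP => j; rewrite !ffunE untagpK //.
  exact/eqP.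
have K (x : {dffun forall j : J, Om (idx j)}) :
    [ffun j => untagp (idx j) ([ffun j => tagp (x j)] j)] = x.
  by apply/ffunP => j; rewrite !ffunE tagpK.
rewrite /prob big_mkcond [RHS]big_mkcond /=; apply: eq_bigr => x _.
have tx : [forall j, tag ([ffun j => tagp (x j)] j) == idx j].
  by apply/forallP => j; rewrite ffunE.
rewrite K eqxx andbT tx.
case: (E x); last by rewrite mulr0.
by rewrite mulr1; apply: eq_bigr => j _; rewrite ffunE pmass_tagp.
Qed.

Section Hypergraphs.
Variables (k : nat) (b : nat -> nat) (c0 : 'I_(b k)).

Definition face_of (I : {set V}) (e : {dffun forall j : {j : V | j \in I}, Om (val j)}) :
  {ffun V -> option point} :=
  [ffun i => if insub i is Some j then Some (tagp (e j)) else None].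

Definition edge_of (I : {set V}) (q : {ffun V -> option point}) :
  {dffun forall j : {j : V | j \in I}, Om (val j)} :=
  [ffun j => if q (val j) is Some t then untagp (val j) t else base (val j)].

Lemma dom_face_of I e : dom (@face_of I e) = I.
Proof.
by apply/setP => i; rewrite inE ffunE; case: insubP => [j -> _|/negPf ->].
Qed.

Lemma face_ofK I : cancel (@face_of I) (@edge_of I).
Proof. by move=> e; apply/ffunP => j; rewrite !ffunE valK tagpK. Qed.

(** A single color type serves all faces: colors are kept at size [k], and a color that does not fit
    becomes [c0]. *)
Definition face_color (G : hypergraph_on k b Om) (q : {ffun V -> option point}) : 'I_(b k) :=
  if (insub (dom q) : option (index_set V k)) is Some J
  then insubd c0 (val (color G (edge_of (val J) q))) else c0.

(** At size [k] the color of [q] always fits; where it does not, the color of [G] is retained. *)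
Definition color_faces (G : hypergraph_on k b Om) (q : {ffun V -> option point} -> 'I_(b k)) :
  hypergraph_on k b Om :=
  Hypergraph (fun I e => insubd (color G e) (val (q (@face_of (val I) e)))).

Lemma face_color_of (G : hypergraph_on k b Om) (I : index_set V k)
    (e : edge (fun i => outcome (Om i)) (val I)) :
  #|val I| = k -> val (face_color G (@face_of (val I) e)) = val (color G e).
Proof.
move=> Ik; rewrite /face_color dom_face_of valK.
rewrite val_insubd [edge_of _ _]face_ofK ifT //.
by rewrite -[X in (_ < b X)%N]Ik ltn_ord.
Qed.

Lemma color_faces_of (G : hypergraph_on k b Om) q (I : index_set V k)
    (e : edge (fun i => outcome (Om i)) (val I)) :
  #|val I| = k -> val (color (color_faces G q) e) = val (q (@face_of (val I) e)).
Proof. by move=> Ik; rewrite /= val_insubd ifT // Ik ltn_ord. Qed.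

(** A random edge of index [I] is the restriction of a random full choice, whose points almost
    surely lie in the right parts. *)
Lemma recolor_le (G : hypergraph_on k b Om) q (I : index_set V k) : #|val I| = k ->
  recolor_prob (color_faces G q) G I <=
  mean (weight pmass id) (fun e => (q (rst (full_face e) (val I)) !=
    face_color G (rst (full_face e) (val I)))%:R).
Proof.
move=> Ik; rewrite /recolor_prob prob_weight.
rewrite -(@mean_weight _ _ _ _ pmass_sum _ _ val id val _ val_inj (fun _ => erefl)).
apply: ler_sum => e _.
have [->|we] := eqVneq (weight pmass id e) 0; first by rewrite !mul0r.
rewrite ler_wpM2l ?weight_ge0 //; first by move=> *; apply: pmass_ge0.
have te i : tag (e i) = i.
  apply: pmass_neq0; apply: contra we => /eqP h.
  by apply/eqP/eqP/prodf_eq0; exists i => //; apply/eqP.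
set x := [ffun j => untagp _ _].
have fx : @face_of (val I) x = rst (full_face e) (val I).
  apply/ffunP => i; rewrite !ffunE; case: insubP => [j iI ji|/negPf -> //].
  by rewrite iI !ffunE untagpK ?te // ji.
rewrite ler_nat -fx; case: eqP => // ne; rewrite lt0b; apply/eqP => h; apply: ne.
by apply: val_inj; rewrite color_faces_of // h face_color_of.
Qed.

End Hypergraphs.
End Points.

Lemma visible_card (V : finType) (k bk : nat) (F : uniform_hypergraph V k bk) e :
  e \in visible_edges F -> #|val (tag e)| = k.
Proof.
rewrite inE => vis; have /andP[_ lek] := valP (tag e).
apply/eqP; rewrite eqn_leq lek leqNgt; apply/negP => ltk.
case ie : (invisible F (tag e)) (invisible_low F ltk) => [c|] // _.
move/eqP: vis; apply; rewrite ie; congr Some; apply: val_inj.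
have u1 : uniform_bound k bk #|val (tag e)| = 1%N by rewrite /uniform_bound ltn_eqF.
have h1 := ltn_ord (color F (tagged e)); have h2 := ltn_ord c.
rewrite [X in (_ < X)%N]u1 in h1; rewrite [X in (_ < X)%N]u1 in h2.
by move: h1 h2; rewrite !ltnS !leqn0 => /eqP /= -> /eqP ->.
Qed.

Section Copies.
Variables (R : realType) (V : finType) (k : nat) (b : nat -> nat) (c0 : 'I_(b k)).
Variables (h : nat) (F : uniform_hypergraph V k (b k)) (hF : h_vertex h F).

Definition vrank i (v : vertices F i) : 'I_h := cast_ord (hF i) (enum_rank v).

Definition vunrank i (x : 'I_h) : vertices F i := enum_val (cast_ord (esym (hF i)) x).

Lemma vrankK i : cancel (@vrank i) (@vunrank i).
Proof. by move=> v; rewrite /vunrank /vrank cast_ordK enum_rankK. Qed.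

Definition vpoint (Om : V -> fin_prob_space R)
    (phi : {dffun forall w : {i : V & vertices F i}, Om (tag w)}) i (x : 'I_h) : point Om :=
  tagp (phi (Tagged (fun i => vertices F i) (vunrank i x))).

Definition vface (I : {set V}) (e : edge (vertices F) I) : {ffun V -> option 'I_h} :=
  [ffun i => if insub i is Some j then Some (vrank (e j)) else None].

Lemma place_vpoint (Om : V -> fin_prob_space R)
    (phi : {dffun forall w : {i : V & vertices F i}, Om (tag w)}) I (e : edge (vertices F) I) :
  place (vpoint phi) (vface e) = face_of (pmap_image (X := fun i => outcome (Om i)) phi e).
Proof.
apply/ffunP => i; rewrite !ffunE; case: insubP => [j _ ji|] //=; subst i.
by rewrite ffunE /vpoint vrankK.
Qed.

(** Given one copy [phi] after recoloring, any choice in which [G] shows the pattern that [q] shows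
    on [phi] is a copy in [G]. *)
Lemma copy_prob_ge (Om Om' : V -> fin_prob_space R) (G : hypergraph_on k b Om)
    (G' : hypergraph_on k b Om') q
    (phi : {dffun forall w : {i : V & vertices F i}, Om' (tag w)}) :
  copy (color_faces G' q) phi ->
  mean (weight (@pmass R V Om) (fst : V * 'I_h -> V)) (fun psi =>
    [forall e, face_color c0 G (place (fun i x => psi (i, x)) e) == q (place (vpoint phi) e)]%:R)
  <= copy_prob G F.
Proof.
move=> /forallP cphi; rewrite /copy_prob (@prob_weight R V Om _ (fun w : {i : V & vertices F i} => tag w)).
pose rho (w : {i : V & vertices F i}) : V * 'I_h := (tag w, vrank (tagged w)).
have rho_inj : injective rho.
  move=> [i v] [j v'] e; have /= ij := congr1 fst e; have /= vv := congr1 snd e.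
  by subst j; rewrite (can_inj (@vrankK i) vv).
rewrite -(@mean_weight _ _ _ _ (@pmass_sum R V Om) _ _ (fun w => tag w) fst rho _ rho_inj (fun _ => erefl)).
apply: ler_sum => psi _.
have [->|we] := eqVneq (weight (@pmass R V Om) fst psi) 0; first by rewrite !mul0r.
rewrite ler_wpM2l ?weight_ge0 //; first by move=> *; apply: pmass_ge0.
have te p : tag (psi p) = p.1.
  apply: pmass_neq0; apply: contra we => /eqP h0.
  by apply/eqP/eqP/prodf_eq0; exists p => //; apply/eqP.
rewrite ler_nat; case: forallP => // hpsi; rewrite lt0b.
set phi2 := [ffun w => untagp _ _].
have pl I (e : edge (vertices F) I) : place (fun i x => psi (i, x)) (vface e) = place (vpoint phi2) (vface e).
  apply/ffunP => i; rewrite !ffunE; case: insubP => [j _ ji|] //=; subst i.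
  by rewrite /vpoint vrankK !ffunE /rho /= untagpK ?te.
apply/forallP => e; apply/implyP => ve.
have ek := visible_card ve.
have := cphi e; rewrite ve => /eqP <-.
rewrite (color_faces_of G' q) // -place_vpoint -(eqP (hpsi _)) pl place_vpoint face_color_of //.
Qed.

End Copies.

Theorem theorem3p2 (R : realType) (r k : nat) (b : nat -> nat) (eps : R)
    (V : finType) (Fam : nat -> uniform_hypergraph V k (b k) -> Prop)
    (hk : (0 < k)%N) (hkr : (k <= r)%N)
    (hb : forall i : nat, (0 < i <= k)%N -> (0 < b i)%N)
    (heps : 0 < eps) (hV : #|V| = r)
    (hFam : forall (h : nat) (F : uniform_hypergraph V k (b k)),
       Fam h F -> h_vertex h F) :
  exists (c : R) (h0 : nat), 0 < c /\
    forall (Om : V -> fin_prob_space R) (G : hypergraph_on k b Om),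
      (exists G' : hypergraph_on k b Om,
         (forall I : index_set V k, #|val I| = k -> recolor_prob G' G I <= eps) /\
         (forall (h : nat) (F : uniform_hypergraph V k (b k)),
            (1 <= h)%N -> Fam h F -> copy_prob G' F = 0))
      \/
      (exists (h : nat) (F : uniform_hypergraph V k (b k)),
         [/\ (1 <= h <= h0)%N, Fam h F & c <= copy_prob G F]).
Proof.
apply: contrapT => no.
(* The constants [c = 1 / (n + 1)] and [h0 = n] fail, which gives the [n]-th counterexample. *)
have bad n : exists p : {Om : V -> fin_prob_space R & hypergraph_on k b Om},
   ~ (exists G' : hypergraph_on k b (tag p),
         (forall I : index_set V k, #|val I| = k -> recolor_prob G' (tagged p) I <= eps) /\
         (forall (h : nat) (F : uniform_hypergraph V k (b k)),
            (1 <= h)%N -> Fam h F -> copy_prob G' F = 0)) /\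
   ~ (exists (h : nat) (F : uniform_hypergraph V k (b k)),
         [/\ (1 <= h <= n)%N, Fam h F & n.+1%:R^-1 <= copy_prob (tagged p) F]).
  apply: contrapT => nop; apply: no; exists n.+1%:R^-1, n; split; first by rewrite invr_gt0.
  move=> Om G; apply: contrapT => /not_orP hG; apply: nop.
  by exists (Tagged (fun Om => hypergraph_on k b Om) G).
have {bad no} [P hP] := choice bad.
pose Om n := tag (P n); pose G n : hypergraph_on k b (Om n) := tagged (P n).
have c0 : 'I_(b k) by apply: Ordinal (hb k _); rewrite hk leqnn.
have [U [UU Uinf]] := ultraFilterLemma eventually_filter.
have Ucof (n0 : nat) : U [set n | (n0 <= n)%N]%classic by apply: Uinf; exists n0.
have [n [q [pq hq]]] := @ultra_removal R V _ c0 (fun n => point (Om n)) (fun n => @pmass R V (Om n))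
  (fun n => face_color c0 (G n)) (fun n => @pmass_ge0 R V (Om n)) (fun n => @pmass_sum R V (Om n)) U UU Ucof eps heps.
have [hi _] := hP n; apply: hi; exists (color_faces (G n) q); split.
  by move=> I Ik; apply: le_trans (recolor_le c0 _ _ Ik) _; apply: hq.
move=> h F h1 hF; apply: big_pred0 => phi; apply/negP => cphi.
have [eta eta0 Ueta] := pq h (vpoint (hFam h F hF) phi).
(* A copy in the repaired structure persists with density [eta]; once [n'] exceeds [h] and
   [1 / eta], this contradicts the failure of the second alternative for the [n']-th
   counterexample. *)
have [n' [hn' hbig]] := ultra_ex UU (ultraI UU Ueta (Ucof (maxn h (Num.bound eta^-1)))).
have [_ []] := hP n'; exists h, F; split=> //.
  by rewrite h1 (leq_trans (leq_maxl _ _) hbig).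
apply: le_trans (copy_prob_ge c0 (hFam h F hF) (G n') cphi).
apply: le_trans hn'; rewrite -[eta]invrK lef_pV2 ?posrE ?invr_gt0 //.
apply: ltW; apply: lt_le_trans (archi_boundP _) _; first by rewrite invr_ge0 ltW.
by rewrite ler_nat (leq_trans _ (leqnSn _)) // (leq_trans (leq_maxr _ _) hbig).
Qed.
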